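(* There is an absolute constant $C$ such that the following holds. Let $p\ge 2$ and $k\ge 3$ be integers, and let $\mathcal F$ be a family of compact convex sets in the plane satisfying the $(p,2)$-property. Assume that every $k$ members of $\mathcal F$ have union complexity less than $\binom k2$. Then $\mathcal F$ has a transversal of size at most $C k^4p^{16}$.
   Context: A family $\mathcal F$ of sets satisfies the $(p,q)$-property if $|\mathcal F|\ge p$, no member is empty, and among any $p$ members there are $q$ with a common point. A transversal of $\mathcal F$ is a set meeting every member of $\mathcal F$. The union complexity of a finite family $\mathcal G$ of planar regions is the number of vertices (points belonging to the boundaries of two distinct members of $\mathcal G$) that lie on the boundary of $\bigcup_{G\in\mathcal G}G$. *)

(* Defs.v *)
From Stdlib Require Import Reals List.
Import ListNotations.
Open Scope R_scope.

Definition point : Type := (R * R)%type.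
Definition region : Type := point -> Prop.

Definition dist2 (a b : point) : R :=
  sqrt ((fst a - fst b)^2 + (snd a - snd b)^2).

Definition ball (c : point) (r : R) : region := fun x => dist2 c x < r.

Definition is_open (U : region) : Prop :=
  forall x, U x -> exists r, 0 < r /\ forall y, ball x r y -> U y.

Definition is_compact (S : region) : Prop :=
  forall (Cov : region -> Prop),
    (forall U, Cov U -> is_open U) ->
    (forall x, S x -> exists U, Cov U /\ U x) ->
    exists l : list region,
      (forall U, In U l -> Cov U) /\
      (forall x, S x -> exists U, In U l /\ U x).

Definition is_convex (S : region) : Prop :=
  forall a b t, S a -> S b -> 0 <= t <= 1 ->
    S (t * fst a + (1 - t) * fst b, t * snd a + (1 - t) * snd b).

Definition interior (S : region) : region :=
  fun x => exists r, 0 < r /\ forall y, ball x r y -> S y.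
Definition closure (S : region) : region :=
  fun x => forall r, 0 < r -> exists y, ball x r y /\ S y.
Definition boundary (S : region) : region :=
  fun x => closure S x /\ ~ interior S x.

Definition nonempty (S : region) : Prop := exists x, S x.

Definition setfamily : Type := region -> Prop.

Definition members (F : setfamily) (l : list region) : Prop :=
  NoDup l /\ forall A, In A l -> F A.

Definition pq_property (p q : nat) (F : setfamily) : Prop :=
  (exists l, members F l /\ length l = p) /\
  (forall A : region, F A -> nonempty A) /\
  (forall l, members F l -> length l = p ->
     exists s, incl s l /\ NoDup s /\ length s = q /\
       exists x, forall A, In A s -> A x).

Definition union_list (G : list region) : region :=
  fun x => exists A, In A G /\ A x.

Definition is_vertex (G : list region) (x : point) : Prop :=
  (exists A B, In A G /\ In B G /\ A <> B /\ boundary A x /\ boundary B x) /\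
  boundary (union_list G) x.

(* "the union complexity of G is less than N": the set of vertices is finite
   with fewer than N elements, i.e. no N distinct vertices exist. *)
Definition union_complexity_lt (G : list region) (N : nat) : Prop :=
  forall vs : list point, NoDup vs -> (forall v, In v vs -> is_vertex G v) ->
    (length vs < N)%nat.

Definition is_transversal (T : list point) (F : setfamily) : Prop :=
  forall A, F A -> exists x, In x T /\ A x.

(* Main.v *)
(** Among [k p^4] members there are [k] pairwise intersecting ones, because disjoint convex
    sets are comparable in one of four partial orders and no [p] members are pairwise
    disjoint.  If no three of these [k] sets had a common point, every pair would contribute
    its own vertex to the boundary of their union, giving [k (k - 1) / 2] vertices.  Hence,
    with [P = k p^4], any [P] members contain three with a common point.

    By the lexicographic-minimum proof of the fractional Helly theorem, for any weights on a
    finite subfamily some point then lies in members of total weight at least a fraction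
    [1 / (4 P^2)].  Multiplicative weights turn this into a multiset of points of which every
    member contains a fraction of order [1 / P^2], and a weak epsilon-net of this multiset, of
    size [O(P^4)], is a transversal of the subfamily.  Finally, transversal numbers of families
    of compact sets are determined by finite subfamilies. *)

From Stdlib Require Import Reals List Arith Lra Lia Psatz Permutation Sorted.
From Stdlib Require Import Classical ClassicalEpsilon ZArith.
Require Import Defs.
Import ListNotations.
Open Scope R_scope.

(** * Compact sets in the plane *)

(** Three is the Helly number of the plane, so once every [P] members contain a meeting triple, the
    scheme of Alon and Kleitman applies; multiplicative weights take the place of linear programming
    duality in it. The depth is quadratic in [1 / P] because the minimum of a triple intersection is
    already the minimum of a pair: a meeting triple is paid for by a third set passing through one
    point fixed by the other two. A weak net for a fraction [e] has size of order [1 / e^2], whence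
    [P^4 = k^4 p^16].

    The geometric obstacle is to find a vertex for each pair. Boundaries may share arcs, and sets
    may touch or have empty interior, so boundary curves are not followed. Instead, a direction is
    found in which both sets reach equally far; the highest point of the intersection in that
    direction lies on the boundary of the union. Besides compactness, the only topological tool
    there is the connectedness of an interval. *)

Definition near (x : point) (r : R) (y : point) : Prop :=
  Rabs (fst y - fst x) < r /\ Rabs (snd y - snd x) < r.

Lemma near_self x r : 0 < r -> near x r x.
Proof. intros H; unfold near; rewrite !Rminus_diag, Rabs_R0; auto. Qed.

Lemma near_le x r s y : r <= s -> near x r y -> near x s y.
Proof. unfold near; lra. Qed.

Lemma ball_near x r y : ball x r y -> near x r y.
Proof.
  unfold ball, dist2, near; intros H.
  rewrite (Rabs_minus_sym (fst y)), (Rabs_minus_sym (snd y)).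
  split; (eapply Rle_lt_trans; [|exact H]);
    rewrite <- sqrt_Rsqr_abs; apply sqrt_le_1_alt; unfold Rsqr;
    set (a := fst x - fst y); set (b := snd x - snd y);
    assert (Ha := pow2_ge_0 a); assert (Hb := pow2_ge_0 b); lra.
Qed.

Lemma near_ball x r y : near x (r / 2) y -> ball x r y.
Proof.
  unfold ball, dist2, near; intros [H1 H2].
  rewrite Rabs_minus_sym in H1, H2.
  set (a := fst x - fst y) in *; set (b := snd x - snd y) in *.
  assert (Ha := Rabs_pos a); assert (Hb := Rabs_pos b).
  apply Rle_lt_trans with (Rabs a + Rabs b); [|lra].
  rewrite <- (sqrt_Rsqr (Rabs a + Rabs b)) by lra.
  apply sqrt_le_1_alt; unfold Rsqr.
  rewrite <- (pow2_abs a), <- (pow2_abs b); nra.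
Qed.

(** Squares replace discs from here on, so that estimates run coordinate by coordinate and without
    square roots. *)
Lemma interior_near S x :
  interior S x <-> exists r, 0 < r /\ forall y, near x r y -> S y.
Proof.
  split; intros (r & Hr & H).
  - exists (r / 2); split; [lra|]; intros y Hy; apply H, near_ball, Hy.
  - exists r; split; [lra|]; intros y Hy; apply H, ball_near, Hy.
Qed.

Lemma is_open_near U :
  (forall x, U x -> exists r, 0 < r /\ forall y, near x r y -> U y) ->
  is_open U.
Proof. intros H x Hx; apply interior_near, H, Hx. Qed.

Definition closed (S : region) : Prop :=
  forall x, ~ S x -> exists r, 0 < r /\ forall y, near x r y -> ~ S y.

Lemma closed_compl_open S : closed S -> is_open (fun x => ~ S x).
Proof. intros H; apply is_open_near; exact H. Qed.

(** The exteriors [far r] of closed squares around [x] cover [S]. A finite subcover has a least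
    radius, and the open square of that radius misses [S]. *)
Lemma compact_closed S : is_compact S -> closed S.
Proof.
  intros HS x Hx.
  set (far := fun (r : R) (y : point) =>
    r < Rabs (fst y - fst x) \/ r < Rabs (snd y - snd x)).
  destruct (HS (fun U => exists r, 0 < r /\ U = far r)) as (l & Hl & Hcov).
  - intros U (r & Hr & ->); apply is_open_near; intros y Hy.
    assert (Htri : forall a b c, Rabs (a - c) <= Rabs (b - a) + Rabs (b - c)).
    { intros a b c; replace (a - c) with ((b - c) - (b - a)) by ring.
      eapply Rle_trans; [apply Rabs_triang|]; rewrite Rabs_Ropp; lra. }
    assert (H1 := Htri (fst y)); assert (H2 := Htri (snd y)).
    destruct Hy as [Hy|Hy].
    + exists (Rabs (fst y - fst x) - r); split; [lra|].
      intros z [Hz _]; left; specialize (H1 (fst z) (fst x)); lra.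
    + exists (Rabs (snd y - snd x) - r); split; [lra|].
      intros z [_ Hz]; right; specialize (H2 (snd z) (snd x)); lra.
  - intros y Hy; destruct (Req_dec (fst y - fst x) 0) as [E1|E1].
    + destruct (Req_dec (snd y - snd x) 0) as [E2|E2].
      * exfalso; apply Hx; replace x with y; auto.
        destruct x, y; simpl in *; f_equal; lra.
      * assert (H := Rabs_pos_lt _ E2).
        exists (far (Rabs (snd y - snd x) / 2)); split.
        -- eexists; split; [|reflexivity]; lra.
        -- right; lra.
    + assert (H := Rabs_pos_lt _ E1).
      exists (far (Rabs (fst y - fst x) / 2)); split.
      * eexists; split; [|reflexivity]; lra.
      * left; lra.
  - assert (Hr : exists r, 0 < r /\ forall U, In U l -> forall y, near x r y -> ~ U y).
    { clear Hcov; induction l as [|U l IH].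
      - exists 1; split; [lra|]; intros U [].
      - destruct IH as (r & Hr & Hd); [intros V HV; apply Hl; now right|].
        destruct (Hl U) as (s & Hs & ->); [now left|].
        exists (Rmin r s); split; [now apply Rmin_glb_lt|].
        intros V [<-|HV] y Hy.
        + apply (near_le _ _ s) in Hy; [|apply Rmin_r].
          unfold near in Hy; unfold far; lra.
        + apply (Hd V HV); eapply near_le; [apply Rmin_l|exact Hy]. }
    destruct Hr as (r & Hr & Hd); exists r; split; [exact Hr|].
    intros y Hy Sy; destruct (Hcov y Sy) as (U & HU & Uy); exact (Hd U HU y Hy Uy).
Qed.

Lemma compact_inter S K :
  is_compact S -> closed K -> is_compact (fun x => S x /\ K x).
Proof.
  intros HS HK Cov Hop Hcov.
  destruct (HS (fun U => Cov U \/ U = (fun x => ~ K x))) as (l & Hl & Hc).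
  - intros U [HU| ->]; [now apply Hop|now apply closed_compl_open].
  - intros x Hx; destruct (classic (K x)) as [Kx|Kx].
    + destruct (Hcov x (conj Hx Kx)) as (U & HU & Ux); eauto.
    + exists (fun x => ~ K x); auto.
  - assert (H : exists l', (forall U, In U l' -> Cov U) /\
      forall U x, In U l -> K x -> U x -> exists V, In V l' /\ V x).
    { clear Hc; induction l as [|U l IH].
      - exists []; simpl; split; intros; contradiction.
      - destruct IH as (l' & H1 & H2); [intros V HV; apply Hl; now right|].
        destruct (Hl U (or_introl eq_refl)) as [HU| ->].
        + exists (U :: l'); split.
          * intros V [<-|HV]; auto.
          * intros V x [<-|HV] Kx Vx; [exists U; simpl; auto|].
            destruct (H2 V x HV Kx Vx) as (W & HW & Wx); exists W; simpl; auto.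
        + exists l'; split; auto.
          intros V x [<-|HV] Kx Vx; [contradiction|eauto]. }
    destruct H as (l' & H1 & H2); exists l'; split; auto.
    intros x [Sx Kx]; destruct (Hc x Sx) as (U & HU & Ux); eauto.
Qed.

Lemma closed_inter S K : closed S -> closed K -> closed (fun x => S x /\ K x).
Proof.
  intros HS HK x Hx; destruct (classic (S x)) as [Sx|Sx].
  - destruct (HK x) as (r & Hr & H); [tauto|]; exists r; split; auto.
    intros y Hy [_ Ky]; exact (H y Hy Ky).
  - destruct (HS x Sx) as (r & Hr & H); exists r; split; auto.
    intros y Hy [Sy _]; exact (H y Hy Sy).
Qed.

Definition cont (f : point -> R) : Prop :=
  forall x e, 0 < e ->
    exists r, 0 < r /\ forall y, near x r y -> Rabs (f y - f x) < e.

Lemma cont_fst : cont fst.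
Proof. intros x e He; exists e; split; auto; intros y []; auto. Qed.

Lemma cont_snd : cont snd.
Proof. intros x e He; exists e; split; auto; intros y []; auto. Qed.

Lemma cont_const c : cont (fun _ => c).
Proof.
  intros x e He; exists 1; split; [lra|]; intros; now rewrite Rminus_diag, Rabs_R0.
Qed.

Lemma cont_plus f g : cont f -> cont g -> cont (fun x => f x + g x).
Proof.
  intros Hf Hg x e He.
  destruct (Hf x (e / 2)) as (r & Hr & H1); [lra|].
  destruct (Hg x (e / 2)) as (s & Hs & H2); [lra|].
  exists (Rmin r s); split; [now apply Rmin_glb_lt|]; intros y Hy.
  specialize (H1 y (near_le _ _ _ _ (Rmin_l _ _) Hy)).
  specialize (H2 y (near_le _ _ _ _ (Rmin_r _ _) Hy)).
  replace (f y + g y - (f x + g x)) with ((f y - f x) + (g y - g x)) by ring.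
  eapply Rle_lt_trans; [apply Rabs_triang|]; lra.
Qed.

Lemma cont_mult f g : cont f -> cont g -> cont (fun x => f x * g x).
Proof.
  intros Hf Hg x e He.
  assert (Ha := Rabs_pos (f x)); assert (Hb := Rabs_pos (g x)).
  set (d := Rmin 1 (e / (1 + Rabs (f x) + Rabs (g x)))).
  assert (Hd : 0 < d).
  { apply Rmin_glb_lt; [lra|]; apply Rdiv_lt_0_compat; lra. }
  assert (Hd1 : d <= 1) by apply Rmin_l.
  assert (Hde : d * (1 + Rabs (f x) + Rabs (g x)) <= e).
  { apply Rmult_le_reg_r with (/ (1 + Rabs (f x) + Rabs (g x))).
    - apply Rinv_0_lt_compat; lra.
    - rewrite Rmult_assoc, Rinv_r, Rmult_1_r by lra; apply Rmin_r. }
  destruct (Hf x d Hd) as (r & Hr & H1), (Hg x d Hd) as (s & Hs & H2).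
  exists (Rmin r s); split; [now apply Rmin_glb_lt|]; intros y Hy.
  specialize (H1 y (near_le _ _ _ _ (Rmin_l _ _) Hy)).
  specialize (H2 y (near_le _ _ _ _ (Rmin_r _ _) Hy)).
  replace (f y * g y - f x * g x) with
    ((f y - f x) * (g y - g x) + (f x * (g y - g x) + (f y - f x) * g x)) by ring.
  eapply Rle_lt_trans; [apply Rabs_triang|].
  assert (Hs2 := Rabs_triang (f x * (g y - g x)) ((f y - f x) * g x)).
  rewrite !Rabs_mult in *.
  assert (P1 := Rabs_pos (f y - f x)); assert (P2 := Rabs_pos (g y - g x)); nra.
Qed.

(** Without a maximum, the open sets [f y < f z] for [z] in [S] cover [S]; in a finite subcover the
    [z] with the largest value is itself uncovered. *)
Lemma compact_max S f :
  is_compact S -> nonempty S -> cont f -> exists z, S z /\ forall y, S y -> f y <= f z.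
Proof.
  intros HS [a Sa] Hf; apply NNPP; intros Hno.
  assert (Hup : forall y, S y -> exists z, S z /\ f y < f z).
  { intros y Sy; apply NNPP; intros H; apply Hno; exists y; split; auto.
    intros z Sz; apply Rnot_lt_le; intros Hlt; apply H; eauto. }
  destruct (HS (fun U => exists z, S z /\ U = fun y => f y < f z)) as (l & Hl & Hc).
  - intros U (z & Sz & ->); apply is_open_near; intros x Hx.
    destruct (Hf x (f z - f x)) as (r & Hr & H); [lra|].
    exists r; split; auto; intros y Hy; specialize (H y Hy).
    apply Rabs_def2 in H; lra.
  - intros y Sy; destruct (Hup y Sy) as (z & Sz & Hz).
    exists (fun y => f y < f z); split; eauto.
  - assert (H : exists z, S z /\ forall U y, In U l -> U y -> f y < f z).
    { clear Hc; induction l as [|U l IH].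
      - exists a; split; [auto|intros U y []].
      - destruct IH as (z & Sz & Hz); [intros V HV; apply Hl; now right|].
        destruct (Hl U (or_introl eq_refl)) as (w & Sw & ->).
        destruct (Rle_dec (f w) (f z)).
        + exists z; split; auto; intros V y [<-|HV] Vy; [simpl in Vy; lra|eauto].
        + exists w; split; auto; intros V y [<-|HV] Vy; [auto|].
          specialize (Hz V y HV Vy); lra. }
    destruct H as (z & Sz & Hz); destruct (Hc z Sz) as (U & HU & Uz).
    specialize (Hz U z HU Uz); lra.
Qed.

Lemma cont_opp f : cont f -> cont (fun x => - f x).
Proof.
  intros Hf x e He; destruct (Hf x e He) as (r & Hr & H); exists r; split; auto.
  intros y Hy; replace (- f y - - f x) with (- (f y - f x)) by ring.
  rewrite Rabs_Ropp; auto.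
Qed.

Definition lexlt (a b : point) : Prop :=
  fst a < fst b \/ fst a = fst b /\ snd a < snd b.

Lemma closed_level f c : cont f -> closed (fun x => f x = c).
Proof.
  intros Hf x Hx; destruct (Hf x (Rabs (c - f x))) as (r & Hr & H).
  - apply Rabs_pos_lt; intros E; apply Hx; lra.
  - exists r; split; auto; intros y Hy <-; specialize (H y Hy); lra.
Qed.

Lemma compact_lexmin S :
  is_compact S -> nonempty S -> exists z, S z /\ forall y, S y -> ~ lexlt y z.
Proof.
  intros HS HN.
  destruct (compact_max S _ HS HN (cont_opp _ cont_fst)) as (a & Sa & Ha).
  destruct (compact_max (fun x => S x /\ fst x = fst a) (fun x => - snd x))
    as (z & [Sz Ez] & Hz).
  - apply compact_inter; auto; apply closed_level, cont_fst.
  - exists a; auto.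
  - apply cont_opp, cont_snd.
  - exists z; split; auto; intros y Sy [Hy|[Ey Hy]].
    + specialize (Ha y Sy); lra.
    + specialize (Hz y (conj Sy (eq_trans Ey Ez))); lra.
Qed.

(** * Convex sets *)

(** The directions of lexicographic descent. They form a convex cone without opposite vectors, so
    any three of them are ordered by angle and one is in the middle. *)
Definition lexneg (v : point) : Prop := fst v < 0 \/ fst v = 0 /\ snd v < 0.

Definition cone (v a b : point) : Prop :=
  exists s t, 0 <= s /\ 0 <= t /\
    fst v = s * fst a + t * fst b /\ snd v = s * snd a + t * snd b.

Lemma cone_of_relation c1 c2 c3 v1 v2 v3 :
  c1 * fst v1 + c2 * fst v2 + c3 * fst v3 = 0 ->
  c1 * snd v1 + c2 * snd v2 + c3 * snd v3 = 0 ->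
  0 < c1 -> c2 <= 0 -> c3 <= 0 -> cone v1 v2 v3.
Proof.
  intros E1 E2 H1 H2 H3; exists (- c2 / c1), (- c3 / c1).
  assert (H : 0 < / c1) by now apply Rinv_0_lt_compat.
  repeat split; try (unfold Rdiv; nra);
    apply Rmult_eq_reg_l with c1; try lra; field_simplify; lra.
Qed.

(* The signs of the coefficients in
   [(v2 x v3) v1 + (v3 x v1) v2 + (v1 x v2) v3 = 0] tell which vector is the middle one. *)
Lemma lexneg_cone v1 v2 v3 :
  lexneg v1 -> lexneg v2 -> lexneg v3 ->
  cone v1 v2 v3 \/ cone v2 v1 v3 \/ cone v3 v1 v2.
Proof.
  intros N1 N2 N3.
  set (c1 := fst v2 * snd v3 - snd v2 * fst v3).
  set (c2 := fst v3 * snd v1 - snd v3 * fst v1).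
  set (c3 := fst v1 * snd v2 - snd v1 * fst v2).
  assert (E1 : c1 * fst v1 + c2 * fst v2 + c3 * fst v3 = 0) by (unfold c1, c2, c3; ring).
  assert (E2 : c1 * snd v1 + c2 * snd v2 + c3 * snd v3 = 0) by (unfold c1, c2, c3; ring).
  (* If [v1] and [v2] are parallel, they cannot be opposite, so [v1] is a nonnegative multiple of
     [v2]. *)
  destruct (Req_dec c3 0) as [Z3|Z3].
  { left; unfold c3 in Z3.
    destruct (Req_dec (fst v2) 0) as [Z2|Z2].
    - assert (snd v2 < 0) by (destruct N2; lra).
      assert (fst v1 = 0).
      { apply Rmult_eq_reg_r with (snd v2); nra. }
      assert (snd v1 < 0) by (destruct N1; lra).
      exists (snd v1 * / snd v2), 0.
      assert (/ snd v2 < 0) by now apply Rinv_lt_0_compat.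
      repeat split; [nra|lra|rewrite Z2; lra|field; lra].
    - assert (fst v2 < 0) by (destruct N2; lra).
      assert (fst v1 <= 0) by (destruct N1; lra).
      exists (fst v1 * / fst v2), 0.
      assert (/ fst v2 < 0) by now apply Rinv_lt_0_compat.
      repeat split; [nra|lra|field; lra|].
      apply Rmult_eq_reg_r with (fst v2); [|lra]; field_simplify; lra. }
  (* A nonnegative combination of descents that uses [v3] is again a descent, hence not zero. This
     excludes the relations whose coefficients all have one sign. *)
  assert (Hpos : forall a b c, 0 <= a -> 0 <= b -> 0 < c ->
    a * fst v1 + b * fst v2 + c * fst v3 = 0 ->
    a * snd v1 + b * snd v2 + c * snd v3 = 0 -> False).
  { intros a b c Ha Hb Hc F1 F2.
    assert (fst v1 <= 0) by (destruct N1; lra).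
    assert (fst v2 <= 0) by (destruct N2; lra).
    assert (fst v3 <= 0) by (destruct N3; lra).
    assert (a * fst v1 = 0) by nra; assert (b * fst v2 = 0) by nra.
    assert (fst v3 = 0) by nra.
    assert (snd v3 < 0) by (destruct N3; lra).
    assert (a * snd v1 <= 0).
    { destruct N1 as [N1|[_ N1]]; [|nra]; assert (a = 0) by nra; subst a; lra. }
    assert (b * snd v2 <= 0).
    { destruct N2 as [N2|[_ N2]]; [|nra]; assert (b = 0) by nra; subst b; lra. }
    nra. }
  assert (D : (0 < c3 \/ c3 < 0) /\ (c1 <= 0 \/ 0 < c1) /\ (c2 <= 0 \/ 0 < c2)) by lra.
  destruct D as [[P3|P3] [[P1|P1] [P2|P2]]].
  - right; right; apply (cone_of_relation c3 c1 c2); lra.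
  - destruct (Req_dec c1 0); [exfalso; apply (Hpos c1 c2 c3); lra|].
    left; apply (cone_of_relation (- c1) (- c2) (- c3)); lra.
  - destruct (Req_dec c2 0); [exfalso; apply (Hpos c1 c2 c3); lra|].
    right; left; apply (cone_of_relation (- c2) (- c1) (- c3)); lra.
  - exfalso; apply (Hpos c1 c2 c3); lra.
  - exfalso; apply (Hpos (- c1) (- c2) (- c3)); lra.
  - right; left; apply (cone_of_relation c2 c1 c3); lra.
  - left; apply (cone_of_relation c1 c2 c3); lra.
  - right; right; apply (cone_of_relation (- c3) (- c1) (- c2)); lra.
Qed.

Definition pminus (a b : point) : point := (fst a - fst b, snd a - snd b).

Lemma convex_pt (S : region) a b t w :
  is_convex S -> S a -> S b -> 0 <= t <= 1 ->
  fst w = t * fst a + (1 - t) * fst b -> snd w = t * snd a + (1 - t) * snd b -> S w.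
Proof.
  intros HS Ha Hb Ht E1 E2; destruct w as [w1 w2]; simpl in *; subst.
  now apply HS.
Qed.

(** The ray from [p] through [q] enters the triangle [p q1 q2], which lies in [D]. A short step from
    [p] along it therefore stays in all three sets and goes down. *)
Lemma cone_descent (A B D : region) p q q1 q2 :
  is_convex A -> is_convex B -> is_convex D ->
  A p -> B p -> D p -> A q -> B q -> D q1 -> D q2 -> lexlt q p ->
  cone (pminus q p) (pminus q1 p) (pminus q2 p) ->
  exists w, A w /\ B w /\ D w /\ lexlt w p.
Proof.
  intros cA cB cD Ap Bp Dp Aq Bq D1 D2 Hlt (s & t & Hs & Ht & E1 & E2).
  unfold pminus in E1, E2; simpl in E1, E2.
  assert (Hst : 0 < s + t).
  { destruct (Req_dec (s + t) 0); [|lra].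
    assert (s = 0) by lra; assert (t = 0) by lra; subst; destruct Hlt; lra. }
  set (m := (s / (s + t) * fst q1 + (1 - s / (s + t)) * fst q2,
             s / (s + t) * snd q1 + (1 - s / (s + t)) * snd q2)).
  assert (Dm : D m).
  { apply cD; auto; split.
    - apply Rmult_le_pos; [lra|]; apply Rlt_le, Rinv_0_lt_compat; lra.
    - apply Rmult_le_reg_r with (s + t); [lra|]; field_simplify; lra. }
  (* This [k] keeps both [k] and [k * (s + t)] at most 1, so [w] lies on the segment from [p] to [q]
     and on the one from [p] to [m]. *)
  set (k := / (1 + s + t)).
  assert (Hk : 0 < k) by (apply Rinv_0_lt_compat; lra).
  assert (Hk1 : k * (1 + s + t) = 1) by (unfold k; field; lra).
  set (w := (k * fst q + (1 - k) * fst p, k * snd q + (1 - k) * snd p)).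
  assert (Hk2 : 0 <= k <= 1) by nra.
  exists w; repeat split.
  - now apply cA.
  - now apply cB.
  - apply (convex_pt D m p (k * (s + t))); auto; [nra| |]; unfold w, m; simpl.
    + replace (fst q) with (fst p + s * (fst q1 - fst p) + t * (fst q2 - fst p)) by lra.
      field; lra.
    + replace (snd q) with (snd p + s * (snd q1 - snd p) + t * (snd q2 - snd p)) by lra.
      field; lra.
  - unfold lexlt, w in *; simpl; destruct Hlt as [H|[H1 H2]]; [left; nra|right].
    rewrite H1; split; nra.
Qed.

Definition lexmin (S : region) (z : point) : Prop :=
  S z /\ forall y, S y -> ~ lexlt y z.

Definition cap (A B : region) : region := fun x => A x /\ B x.

(* Helly's theorem for [A], [B], [D] and the convex set of points below [p]. *)
Lemma lexmin_triple (A B D : region) p :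
  is_convex A -> is_convex B -> is_convex D ->
  lexmin (fun x => A x /\ B x /\ D x) p ->
  lexmin (cap A B) p \/ lexmin (cap A D) p \/ lexmin (cap B D) p.
Proof.
  intros cA cB cD [(Ap & Bp & Dp) Hmin].
  assert (Hq : forall S T : region, S p -> T p -> ~ lexmin (cap S T) p ->
    exists q, S q /\ T q /\ lexlt q p).
  { intros S T Sp Tp Hn; apply NNPP; intros Hno; apply Hn; split; [split; auto|].
    intros y [Sy Ty] Hlt; apply Hno; eauto. }
  apply NNPP; intros Hno.
  destruct (Hq A B) as (q1 & A1 & B1 & L1); [tauto..|].
  destruct (Hq A D) as (q2 & A2 & D2 & L2); [tauto..|].
  destruct (Hq B D) as (q3 & B3 & D3 & L3); [tauto..|].
  assert (HL : forall q, lexlt q p -> lexneg (pminus q p)).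
  { intros q; unfold lexlt, lexneg, pminus; simpl; intros [H|[H H']]; [left|right]; lra. }
  (* Each [q] lies in two of the sets. The set not known to contain the middle point contains the
     two outer ones, so [cone_descent] applies. *)
  destruct (lexneg_cone _ _ _ (HL _ L1) (HL _ L2) (HL _ L3)) as [H|[H|H]].
  - destruct (cone_descent A B D p q1 q2 q3) as (w & ? & ? & ? & L); auto.
    apply (Hmin w); auto.
  - destruct (cone_descent A D B p q2 q1 q3) as (w & ? & ? & ? & L); auto.
    apply (Hmin w); auto.
  - destruct (cone_descent B D A p q3 q1 q2) as (w & ? & ? & ? & L); auto.
    apply (Hmin w); auto.
Qed.

Lemma lexmin_unique S y z : lexmin S y -> lexmin S z -> y = z.
Proof.
  intros [Sy Hy] [Sz Hz]; specialize (Hy z Sz); specialize (Hz y Sy).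
  unfold lexlt in *; destruct y as [y1 y2], z as [z1 z2]; simpl in *.
  destruct (Rtotal_order y1 z1) as [H|[H|H]]; [tauto| |tauto].
  destruct (Rtotal_order y2 z2) as [H'|[H'|H']]; [tauto|congruence|].
  exfalso; apply Hy; right; auto.
Qed.

(** * Common tangents and a vertex for each pair *)

(** Connectedness of the unit interval: the supremum of [P] belongs to [P], points just to its right
    belong to [Q], and [Q] is closed. It is applied to a turning direction and to a short
    segment. *)
Lemma closed_cover_meet (P Q : R -> Prop) :
  (forall t, 0 <= t <= 1 -> P t \/ Q t) ->
  (forall t, ~ P t -> exists d, 0 < d /\ forall s, Rabs (s - t) < d -> ~ P s) ->
  (forall t, ~ Q t -> exists d, 0 < d /\ forall s, Rabs (s - t) < d -> ~ Q s) ->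
  P 0 -> Q 1 -> exists t, 0 <= t <= 1 /\ P t /\ Q t.
Proof.
  intros Hcov HP HQ P0 Q1.
  destruct (completeness (fun t => 0 <= t <= 1 /\ P t)) as (s & Hub & Hlub).
  - exists 1; intros t [Ht _]; lra.
  - exists 0; split; [lra|auto].
  - assert (Hs0 : 0 <= s) by (apply Hub; split; [lra|auto]).
    assert (Hs1 : s <= 1) by (apply Hlub; intros t [Ht _]; lra).
    assert (Ps : P s).
    { apply NNPP; intros Hn; destruct (HP s Hn) as (d & Hd & H).
      assert (s <= s - d); [|lra]; apply Hlub; intros t [Ht Pt].
      assert (t <= s) by (apply Hub; auto).
      apply Rnot_lt_le; intros Hlt; apply (H t); [apply Rabs_def1; lra|auto]. }
    exists s; repeat split; auto.
    destruct (Req_dec s 1) as [->|Hne]; auto.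
    apply NNPP; intros Hn; destruct (HQ s Hn) as (d & Hd & H).
    set (t := s + Rmin (d / 2) (1 - s)).
    assert (H1 := Rmin_l (d / 2) (1 - s)); assert (H2 := Rmin_r (d / 2) (1 - s)).
    assert (H3 : 0 < Rmin (d / 2) (1 - s)) by (apply Rmin_glb_lt; lra).
    assert (Ht : 0 <= t <= 1) by (unfold t; lra).
    destruct (Hcov t Ht) as [Pt|Qt].
    + assert (t <= s) by (apply Hub; auto); unfold t in *; lra.
    + apply (H t); auto; unfold t; apply Rabs_def1; lra.
Qed.

Definition dot (u x : point) : R := fst u * fst x + snd u * snd x.

Lemma cont_dot u : cont (dot u).
Proof.
  apply cont_plus; apply cont_mult; auto using cont_const, cont_fst, cont_snd.
Qed.

(** The direction runs to [x] from its nearest point [c] in [B]. A point of [B] beyond [c] in that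
    direction would allow a step from [c] closer to [x]. *)
Lemma separation (B : region) x :
  is_compact B -> is_convex B -> nonempty B -> ~ B x ->
  exists u, forall b, B b -> dot u b < dot u x.
Proof.
  intros HB cB nB Hx.
  destruct (compact_max B (fun b => - ((fst b + - fst x) * (fst b + - fst x)
    + (snd b + - snd x) * (snd b + - snd x)))) as (c & Bc & Hc); auto.
  { apply cont_opp, cont_plus; apply cont_mult; apply cont_plus;
      auto using cont_fst, cont_snd, cont_const. }
  exists (pminus x c); intros b Bb; unfold dot, pminus; simpl.
  assert (Hn : 0 < (fst x - fst c) ^ 2 + (snd x - snd c) ^ 2).
  { assert (H1 := pow2_ge_0 (fst x - fst c)); assert (H2 := pow2_ge_0 (snd x - snd c)).
    apply Rnot_le_lt; intros H; apply Hx; replace x with c; auto.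
    destruct x, c; simpl in *; f_equal; nra. }
  set (e := (fst x - fst c) * (fst b - fst c) + (snd x - snd c) * (snd b - snd c)).
  assert (He : e <= 0).
  { apply Rnot_lt_le; intros He.
    set (D := (fst b - fst c) ^ 2 + (snd b - snd c) ^ 2).
    assert (HD : 0 <= D).
    { unfold D; assert (H1 := pow2_ge_0 (fst b - fst c));
        assert (H2 := pow2_ge_0 (snd b - snd c)); lra. }
    (* A step [t] changes the squared distance by [t * (t * D - 2 * e)]. This [t] makes [t * D] at
       most [e], so the change is negative, and the added [e] in the denominator keeps [t] at most
       1. *)
    set (t := e / (D + e)).
    assert (Ht : t * (D + e) = e) by (unfold t; field; lra).
    assert (Ht0 : 0 < t) by (apply Rdiv_lt_0_compat; lra).
    assert (Ht1 : t <= 1) by nra.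
    specialize (Hc _ (cB b c t Bb Bc (conj (Rlt_le _ _ Ht0) Ht1))); simpl in Hc.
    assert (0 <= t * (t * D - 2 * e)) by (unfold D, e; nra).
    nra. }
  unfold e in He; nra.
Qed.

Lemma sum_sq_pos a b : ~ (a = 0 /\ b = 0) -> 0 < a ^ 2 + b ^ 2.
Proof.
  intros H; assert (Ha := pow2_ge_0 a); assert (Hb := pow2_ge_0 b).
  destruct (Req_dec a 0) as [->|Na].
  - assert (Nb : b <> 0) by tauto; assert (Q := Rsqr_pos_lt _ Nb); unfold Rsqr in Q; lra.
  - assert (Q := Rsqr_pos_lt _ Na); unfold Rsqr in Q; lra.
Qed.

(** Comparison of the support functions of [A] and [B] in direction [u], phrased without naming
    their maxima. *)
Definition dom (u : point) (A B : region) : Prop :=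
  forall a, A a -> exists b, B b /\ dot u a <= dot u b.

Lemma dom_total u A B : dom u A B \/ dom u B A.
Proof.
  destruct (classic (dom u A B)) as [H|H]; auto; right.
  intros b Bb; apply NNPP; intros Hn; apply H; intros a Aa.
  exists b; split; auto; apply Rnot_lt_le; intros Hlt; apply Hn; exists a; split; auto; lra.
Qed.

Definition lerp (u v : point) (t : R) : point :=
  ((1 - t) * fst u + t * fst v, (1 - t) * snd u + t * snd v).

Lemma dot_lerp u v t x : dot (lerp u v t) x = (1 - t) * dot u x + t * dot v x.
Proof. unfold dot, lerp; simpl; ring. Qed.

(** If [a] beats all of compact [B] in one direction, it does so with a gap [g]. Since [K] bounds
    how fast the difference between [a] and any point of [B] varies with the direction, nearby
    directions keep part of the gap. *)
Lemma dom_closed A B u v t :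
  is_compact B -> nonempty B -> ~ dom (lerp u v t) A B ->
  exists d, 0 < d /\ forall s, Rabs (s - t) < d -> ~ dom (lerp u v s) A B.
Proof.
  intros HB nB Hn.
  assert (H : exists a, A a /\ forall b, B b -> dot (lerp u v t) b < dot (lerp u v t) a).
  { apply NNPP; intros Hno; apply Hn; intros a Aa; apply NNPP; intros Hb; apply Hno.
    exists a; split; auto; intros b Bb; apply Rnot_le_lt; intros Hle; eauto. }
  destruct H as (a & Aa & Ha).
  destruct (compact_max B (dot (lerp u v t))) as (b0 & Bb0 & Hb0); auto using cont_dot.
  set (w := pminus v u).
  destruct (compact_max B (dot w)) as (hi & _ & Hhi); auto using cont_dot.
  destruct (compact_max B (fun x => - dot w x)) as (lo & _ & Hlo);
    auto using cont_dot, cont_opp.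
  specialize (Ha b0 Bb0).
  set (g := dot (lerp u v t) a - dot (lerp u v t) b0).
  set (K := Rabs (dot w hi) + Rabs (dot w lo) + Rabs (dot w a) + 1).
  assert (P1 := Rabs_pos (dot w hi)); assert (P2 := Rabs_pos (dot w lo));
    assert (P3 := Rabs_pos (dot w a)).
  exists (g / K); split; [apply Rdiv_lt_0_compat; unfold g, K; lra|].
  intros s Hs Hd; destruct (Hd a Aa) as (b & Bb & Hle).
  assert (Hb1 := Hb0 b Bb); assert (Hb2 := Hhi b Bb); assert (Hb3 := Hlo b Bb).
  assert (E : forall x, dot (lerp u v s) x = dot (lerp u v t) x + (s - t) * dot w x).
  { intros x; unfold w; rewrite !dot_lerp; unfold dot, pminus; simpl; ring. }
  rewrite !E in Hle.
  assert (Hw : Rabs (dot w a - dot w b) <= K).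
  { assert (Q1 := Rle_abs (dot w hi)); assert (Q2 := Rle_abs (dot w a)).
    assert (Q3 := Rle_abs (- dot w lo)); assert (Q4 := Rle_abs (- dot w a)).
    rewrite Rabs_Ropp in Q3, Q4; apply Rabs_le; unfold K; lra. }
  assert (Hg : Rabs (s - t) * K < g).
  { apply Rmult_lt_reg_r with (/ K); [apply Rinv_0_lt_compat; unfold K; lra|].
    rewrite Rmult_assoc, Rinv_r, Rmult_1_r by (unfold K; lra); exact Hs. }
  assert (Hm : Rabs ((s - t) * (dot w a - dot w b)) < g).
  { rewrite Rabs_mult; assert (P4 := Rabs_pos (s - t)); nra. }
  apply Rabs_def2 in Hm; unfold g in *; lra.
Qed.

(** Separation gives one direction in which [A] reaches farther and one in which [B] does. On the
    way between them the support functions agree, and linear independence of the two ends keeps the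
    path away from the zero vector. *)
Lemma common_tangent (A B : region) :
  is_compact A -> is_convex A -> is_compact B -> is_convex B ->
  (exists x, A x /\ ~ B x) -> (exists y, B y /\ ~ A y) ->
  exists u, (fst u <> 0 \/ snd u <> 0) /\ dom u A B /\ dom u B A.
Proof.
  intros HA cA HB cB (x & Ax & Bx) (y & By & Ay).
  assert (nA : nonempty A) by now exists x.
  assert (nB : nonempty B) by now exists y.
  destruct (separation B x) as (u & Hu); auto.
  destruct (separation A y) as (v & Hv); auto.
  assert (Du : dom u B A) by (intros b Bb; exists x; split; auto; apply Rlt_le; auto).
  assert (Dv : dom v A B) by (intros a Aa; exists y; split; auto; apply Rlt_le; auto).
  assert (Key : forall p q, dom p B A -> dom q A B ->
    fst p * snd q - snd p * fst q <> 0 ->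
    exists u, (fst u <> 0 \/ snd u <> 0) /\ dom u A B /\ dom u B A).
  { intros p q Dp Dq Hpq.
    destruct (closed_cover_meet (fun t => dom (lerp p q t) B A)
      (fun t => dom (lerp p q t) A B)) as (t & Ht & D1 & D2).
    - intros; apply dom_total.
    - intros t; now apply dom_closed.
    - intros t; now apply dom_closed.
    - intros b Bb; destruct (Dp b Bb) as (a & Aa & H); exists a; split; auto.
      rewrite !dot_lerp; lra.
    - intros b Bb; destruct (Dq b Bb) as (a & Aa & H); exists a; split; auto.
      rewrite !dot_lerp; lra.
    - exists (lerp p q t); repeat split; auto; unfold lerp; simpl.
      apply NNPP; intros Hz.
      assert (E1 : (1 - t) * fst p + t * fst q = 0) by (apply NNPP; intros ?; auto).
      assert (E2 : (1 - t) * snd p + t * snd q = 0) by (apply NNPP; intros ?; auto).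
      apply Hpq.
      replace (fst p * snd q - snd p * fst q) with
        (((1 - t) * fst p + t * fst q) * (snd q - snd p)
         - ((1 - t) * snd p + t * snd q) * (fst q - fst p)) by ring.
      rewrite E1, E2; ring. }
  destruct (Req_dec (fst u * snd v - snd u * fst v) 0) as [Z|Z]; [|eauto].
  (* [u] and [v] may be opposite: go through a perpendicular direction *)
  set (n := (- snd u, fst u)).
  assert (Nu : 0 < fst u ^ 2 + snd u ^ 2).
  { apply sum_sq_pos; intros [E1 E2]; assert (Q := Hu y By).
    unfold dot in Q; rewrite E1, E2 in Q; lra. }
  assert (Nv : 0 < fst v ^ 2 + snd v ^ 2).
  { apply sum_sq_pos; intros [E1 E2]; assert (Q := Hv x Ax).
    unfold dot in Q; rewrite E1, E2 in Q; lra. }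
  destruct (dom_total n A B) as [Dn|Dn].
  - apply (Key u n); auto; unfold n; simpl; nra.
  - apply (Key n v); auto; unfold n; simpl; intros E.
    assert (F1 : fst v * (fst u ^ 2 + snd u ^ 2) = 0).
    { replace (fst v * (fst u ^ 2 + snd u ^ 2)) with
        (fst u * (fst u * fst v + snd u * snd v)
         - snd u * (fst u * snd v - snd u * fst v)) by ring; nra. }
    assert (F2 : snd v * (fst u ^ 2 + snd u ^ 2) = 0).
    { replace (snd v * (fst u ^ 2 + snd u ^ 2)) with
        (snd u * (fst u * fst v + snd u * snd v)
         + fst u * (fst u * snd v - snd u * fst v)) by ring; nra. }
    apply Rmult_integral in F1; apply Rmult_integral in F2.
    assert (Ev1 : fst v = 0) by lra; assert (Ev2 : snd v = 0) by lra.
    rewrite Ev1, Ev2 in Nv; lra.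
Qed.

Definition cup (A B : region) : region := fun x => A x \/ B x.

(* Just above [z], a segment near [z] from the segment [za] to the segment [zb]
   would lie in the union, hence meet the intersection. *)
Lemma top_not_interior (A B : region) u a b z :
  closed A -> closed B -> is_convex A -> is_convex B ->
  A a -> B b -> cap A B z -> dot u z < dot u a -> dot u z < dot u b ->
  (forall y, cap A B y -> dot u y <= dot u z) ->
  ~ interior (cup A B) z.
Proof.
  intros HA HB cA cB Aa Bb [Az Bz] La Lb Htop Hint.
  apply interior_near in Hint; destruct Hint as (r & Hr & Hin).
  set (K := Rabs (fst a - fst z) + Rabs (snd a - snd z) + Rabs (fst b - fst z)
    + Rabs (snd b - snd z) + r).
  assert (P1 := Rabs_pos (fst a - fst z)); assert (P2 := Rabs_pos (snd a - snd z));
  assert (P3 := Rabs_pos (fst b - fst z)); assert (P4 := Rabs_pos (snd b - snd z)).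
  (* Contracting towards [z] by [s] brings the segment [ab] into the square of radius [r]; the
     summand [r] in [K] makes [s] at most 1. *)
  set (s := r / K).
  assert (HK : 0 < K) by (unfold K; lra).
  assert (Hs0 : 0 < s) by now apply Rdiv_lt_0_compat.
  assert (HsK : s * K = r) by (unfold s; field; lra).
  assert (Hs1 : s <= 1) by (unfold K in HsK; nra).
  set (w := fun t => (fst z + s * ((1 - t) * (fst a - fst z) + t * (fst b - fst z)),
                      snd z + s * ((1 - t) * (snd a - snd z) + t * (snd b - snd z)))).
  assert (Hcl : forall S, closed S -> forall t, ~ S (w t) ->
    exists d, 0 < d /\ forall t', Rabs (t' - t) < d -> ~ S (w t')).
  { intros S HS t St; destruct (HS _ St) as (e & He & H).
    set (L := Rabs (fst b - fst a) + Rabs (snd b - snd a) + 1).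
    assert (Q1 := Rabs_pos (fst b - fst a)); assert (Q2 := Rabs_pos (snd b - snd a)).
    exists (e / L); split; [apply Rdiv_lt_0_compat; unfold L; lra|].
    intros t' Ht'; apply H.
    assert (HL : Rabs (t' - t) * L < e).
    { apply Rmult_lt_reg_r with (/ L); [apply Rinv_0_lt_compat; unfold L; lra|].
      rewrite Rmult_assoc, Rinv_r, Rmult_1_r by (unfold L; lra); exact Ht'. }
    assert (Q3 := Rabs_pos (t' - t)).
    split; unfold w; simpl.
    - match goal with |- Rabs ?x < _ =>
        replace x with (s * ((t' - t) * (fst b - fst a))) by ring end.
      rewrite !Rabs_mult, (Rabs_pos_eq s) by lra; unfold L in HL.
      assert (0 <= Rabs (t' - t) * Rabs (fst b - fst a)) by now apply Rmult_le_pos.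
      assert (0 <= Rabs (t' - t) * Rabs (snd b - snd a)) by now apply Rmult_le_pos.
      nra.
    - match goal with |- Rabs ?x < _ =>
        replace x with (s * ((t' - t) * (snd b - snd a))) by ring end.
      rewrite !Rabs_mult, (Rabs_pos_eq s) by lra; unfold L in HL.
      assert (0 <= Rabs (t' - t) * Rabs (fst b - fst a)) by now apply Rmult_le_pos.
      assert (0 <= Rabs (t' - t) * Rabs (snd b - snd a)) by now apply Rmult_le_pos.
      nra. }
  destruct (closed_cover_meet (fun t => A (w t)) (fun t => B (w t)))
    as (t & Ht & Awt & Bwt).
  - intros t Ht; apply Hin; split; unfold w; simpl.
    + match goal with |- Rabs (?x) < _ =>
        replace x with (s * ((1 - t) * (fst a - fst z) + t * (fst b - fst z))) by ring end.
      rewrite Rabs_mult, (Rabs_pos_eq s) by lra.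
      assert (Q := Rabs_triang ((1 - t) * (fst a - fst z)) (t * (fst b - fst z))).
      rewrite !Rabs_mult, (Rabs_pos_eq t), (Rabs_pos_eq (1 - t)) in Q by lra.
      rewrite <- HsK; apply Rmult_lt_compat_l; auto; unfold K; nra.
    + match goal with |- Rabs (?x) < _ =>
        replace x with (s * ((1 - t) * (snd a - snd z) + t * (snd b - snd z))) by ring end.
      rewrite Rabs_mult, (Rabs_pos_eq s) by lra.
      assert (Q := Rabs_triang ((1 - t) * (snd a - snd z)) (t * (snd b - snd z))).
      rewrite !Rabs_mult, (Rabs_pos_eq t), (Rabs_pos_eq (1 - t)) in Q by lra.
      rewrite <- HsK; apply Rmult_lt_compat_l; auto; unfold K; nra.
  - now apply Hcl.
  - now apply Hcl.
  - apply (convex_pt A a z s); auto; [lra| |]; unfold w; simpl; ring.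
  - apply (convex_pt B b z s); auto; [lra| |]; unfold w; simpl; ring.
  - specialize (Htop (w t) (conj Awt Bwt)).
    assert (E : dot u (w t) = dot u z +
      s * ((1 - t) * (dot u a - dot u z) + t * (dot u b - dot u z))).
    { unfold dot, w; simpl; ring. }
    assert (0 < (1 - t) * (dot u a - dot u z) + t * (dot u b - dot u z)).
    { destruct (Req_dec t 0) as [->|Hne]; [lra|].
      assert (0 < t) by lra; nra. }
    nra.
Qed.

(** Take [z] highest in the intersection along a common tangent direction. If [A] rises above [z],
    then so does [B], and [top_not_interior] applies. Otherwise neither set rises above [z], and the
    points just above it lie outside both. *)
Lemma vertex_exists (A B : region) :
  is_compact A -> is_convex A -> is_compact B -> is_convex B ->
  nonempty (cap A B) ->
  (exists x, A x /\ ~ B x) -> (exists y, B y /\ ~ A y) ->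
  exists z, cap A B z /\ ~ interior (cup A B) z.
Proof.
  intros HA cA HB cB nAB xA yB.
  destruct (common_tangent A B) as (u & Hu & DA & DB); auto.
  destruct (compact_max (cap A B) (dot u)) as (z & Hz & Htop); auto using cont_dot.
  { apply compact_inter; auto using compact_closed. }
  exists z; split; auto.
  destruct (classic (exists a, A a /\ dot u z < dot u a)) as [(a & Aa & La)|Hno].
  - destruct (DA a Aa) as (b & Bb & Hab).
    apply (top_not_interior A B u a b); auto using compact_closed; lra.
  - assert (HAz : forall a, A a -> dot u a <= dot u z).
    { intros a Aa; apply Rnot_lt_le; intros H; apply Hno; eauto. }
    intros Hint; apply interior_near in Hint; destruct Hint as (r & Hr & Hin).
    assert (P1 := Rabs_pos (fst u)); assert (P2 := Rabs_pos (snd u)).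
    set (K := Rabs (fst u) + Rabs (snd u) + 1).
    set (s := r / K).
    assert (HK : 0 < K) by (unfold K; lra).
    assert (Hs0 : 0 < s) by now apply Rdiv_lt_0_compat.
    assert (HsK : s * K = r) by (unfold s; field; lra).
    set (w := (fst z + s * fst u, snd z + s * snd u)).
    assert (Nu : 0 < fst u ^ 2 + snd u ^ 2).
    { apply sum_sq_pos; tauto. }
    assert (Hw : dot u z < dot u w).
    { unfold dot, w; simpl; nra. }
    destruct (Hin w) as [Aw|Bw].
    + split; unfold w; simpl.
      * replace (fst z + s * fst u - fst z) with (s * fst u) by ring.
        rewrite Rabs_mult, (Rabs_pos_eq s) by lra; unfold K in HsK; nra.
      * replace (snd z + s * snd u - snd z) with (s * snd u) by ring.
        rewrite Rabs_mult, (Rabs_pos_eq s) by lra; unfold K in HsK; nra.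
    + specialize (HAz w Aw); lra.
    + destruct (DB w Bw) as (a & Aa & Hle); specialize (HAz a Aa); lra.
Qed.

(** * Four orders on disjoint convex sets *)

Definition left_of (A B : region) : Prop :=
  forall b, B b -> exists a, A a /\ fst a <= fst b.
Definition right_of (A B : region) : Prop :=
  forall b, B b -> exists a, A a /\ fst b <= fst a.
(** This holds vacuously, in both directions, for sets that no vertical line meets together; only
    the comparison of the ends of their projections then distinguishes them. *)
Definition below (A B : region) : Prop :=
  forall a b, A a -> B b -> fst a = fst b -> snd a < snd b.

Lemma left_of_total A B : left_of A B \/ left_of B A.
Proof.
  destruct (classic (left_of A B)) as [H|H]; auto; right.
  intros a Aa; apply NNPP; intros Hn; apply H; intros b Bb.
  exists a; split; auto; apply Rnot_lt_le; intros Hlt; apply Hn; exists b; split; auto; lra.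
Qed.

Lemma right_of_total A B : right_of A B \/ right_of B A.
Proof.
  destruct (classic (right_of A B)) as [H|H]; auto; right.
  intros a Aa; apply NNPP; intros Hn; apply H; intros b Bb.
  exists a; split; auto; apply Rnot_lt_le; intros Hlt; apply Hn; exists b; split; auto; lra.
Qed.

Lemma left_of_trans A B C : left_of A B -> left_of B C -> left_of A C.
Proof.
  intros H1 H2 c Cc; destruct (H2 c Cc) as (b & Bb & Hb), (H1 b Bb) as (a & Aa & Ha).
  exists a; split; auto; lra.
Qed.

Lemma right_of_trans A B C : right_of A B -> right_of B C -> right_of A C.
Proof.
  intros H1 H2 c Cc; destruct (H2 c Cc) as (b & Bb & Hb), (H1 b Bb) as (a & Aa & Ha).
  exists a; split; auto; lra.
Qed.

(** If [A] is above [B] on one vertical line by [g] and below it on another by [h], the weight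
    [h / (g + h)] interpolates both pairs to the same height, giving a common point. *)
Lemma below_total A B :
  is_convex A -> is_convex B -> ~ nonempty (cap A B) -> below A B \/ below B A.
Proof.
  intros cA cB Hd; apply NNPP; intros Hn.
  assert (H1 : exists a b, A a /\ B b /\ fst a = fst b /\ snd b <= snd a).
  { apply NNPP; intros H; apply Hn; left; intros a b Aa Bb E.
    apply Rnot_le_lt; intros Hle; apply H; exists a, b; auto. }
  assert (H2 : exists a b, A a /\ B b /\ fst a = fst b /\ snd a <= snd b).
  { apply NNPP; intros H; apply Hn; right; intros b a Bb Aa E.
    apply Rnot_le_lt; intros Hle; apply H; exists a, b; auto. }
  destruct H1 as (a & b & Aa & Bb & E & H1), H2 as (a' & b' & Aa' & Bb' & E' & H2).
  destruct (Req_dec (snd a) (snd b)) as [F|F].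
  { apply Hd; exists a; split; auto; replace a with b; auto.
    destruct a, b; simpl in *; congruence. }
  set (g := snd a - snd b); set (h := snd b' - snd a').
  assert (Hg : 0 < g) by (unfold g; lra); assert (Hh : 0 <= h) by (unfold h; lra).
  set (t := h / (g + h)).
  assert (Ht : t * (g + h) = h) by (unfold t; field; lra).
  assert (Ht1 : 0 <= t <= 1).
  { split; [apply Rmult_le_pos; [lra|apply Rlt_le, Rinv_0_lt_compat; lra]|nra]. }
  apply Hd; eexists; split; [apply (cA a a' t); auto|].
  apply (convex_pt B b b' t); auto; simpl; [congruence|].
  unfold g, h in Ht; nra.
Qed.

(** Alone, [below] is not transitive, since [B] may miss the vertical line through [a] and [c].
    [Hmid] gives points of [B] on either side of that line; the comparisons of ends in the four
    orders supply it. *)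
Lemma below_trans A B C :
  is_convex B ->
  (forall a c, A a -> C c -> fst a = fst c ->
    (exists b, B b /\ fst b <= fst a) /\ (exists b, B b /\ fst a <= fst b)) ->
  below A B -> below B C -> below A C.
Proof.
  intros cB Hmid H1 H2 a c Aa Cc E.
  destruct (Hmid a c Aa Cc E) as [(b & Bb & L) (b' & Bb' & L')].
  assert (H : exists w, B w /\ fst w = fst a).
  { destruct (Req_dec (fst b) (fst b')) as [F|F]; [exists b; split; auto; lra|].
    set (t := (fst b' - fst a) / (fst b' - fst b)).
    assert (Ht : t * (fst b' - fst b) = fst b' - fst a) by (unfold t; field; lra).
    assert (Ht1 : 0 <= t <= 1) by (split; nra).
    eexists; split; [apply (cB b b' t); auto|simpl; nra]. }
  destruct H as (w & Bw & Ew).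
  specialize (H1 a w Aa Bw (eq_sym Ew)).
  specialize (H2 w c Bw Cc (eq_trans Ew E)); lra.
Qed.

Lemma below_disjoint A B : below A B -> ~ nonempty (cap A B).
Proof. intros H (x & Ax & Bx); specialize (H x x Ax Bx eq_refl); lra. Qed.

(* Two disjoint convex sets are comparable in one of these four orders
   (Larman, Matousek, Pach and Torocsik). *)
Definition shift_up (A B : region) : Prop := left_of A B /\ right_of B A /\ below A B.
Definition shift_down (A B : region) : Prop := left_of A B /\ right_of B A /\ below B A.
Definition nest_up (A B : region) : Prop := left_of B A /\ right_of B A /\ below A B.
Definition nest_down (A B : region) : Prop := left_of B A /\ right_of B A /\ below B A.

Definition transitive_on (P : region -> Prop) (Rel : region -> region -> Prop) : Prop :=
  forall A B C, P A -> P B -> P C -> Rel A B -> Rel B C -> Rel A C.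

Lemma shift_up_trans : transitive_on is_convex shift_up.
Proof.
  intros A B C _ cB _ (L1 & R1 & U1) (L2 & R2 & U2); repeat split.
  - now apply left_of_trans with B.
  - now apply right_of_trans with B.
  - apply below_trans with B; auto; intros a c Aa Cc E; split.
    + destruct (L2 c Cc) as (b & ? & ?); exists b; split; auto; lra.
    + destruct (R1 a Aa) as (b & ? & ?); exists b; split; auto; lra.
Qed.

Lemma shift_down_trans : transitive_on is_convex shift_down.
Proof.
  intros A B C _ cB _ (L1 & R1 & U1) (L2 & R2 & U2); repeat split.
  - now apply left_of_trans with B.
  - now apply right_of_trans with B.
  - apply below_trans with B; auto; intros c a Cc Aa E; split.
    + destruct (L2 c Cc) as (b & ? & ?); exists b; split; auto; lra.
    + destruct (R1 a Aa) as (b & ? & ?); exists b; split; auto; lra.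
Qed.

Lemma nest_up_trans : transitive_on is_convex nest_up.
Proof.
  intros A B C _ cB _ (L1 & R1 & U1) (L2 & R2 & U2); repeat split.
  - now apply left_of_trans with B.
  - now apply right_of_trans with B.
  - apply below_trans with B; auto.
Qed.

Lemma nest_down_trans : transitive_on is_convex nest_down.
Proof.
  intros A B C _ cB _ (L1 & R1 & U1) (L2 & R2 & U2); repeat split.
  - now apply left_of_trans with B.
  - now apply right_of_trans with B.
  - apply below_trans with B; auto; intros c a Cc Aa E; split.
    + destruct (L1 a Aa) as (b & ? & ?); exists b; split; auto; lra.
    + destruct (R1 a Aa) as (b & ? & ?); exists b; split; auto; lra.
Qed.

(** The eight outcomes of comparing left ends, right ends and heights are exactly the four orders
    and their converses. *)
Lemma disjoint_comparable A B :
  is_convex A -> is_convex B -> ~ nonempty (cap A B) ->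
  (shift_up A B \/ shift_down A B \/ nest_up A B \/ nest_down A B) \/
  (shift_up B A \/ shift_down B A \/ nest_up B A \/ nest_down B A).
Proof.
  intros cA cB Hd; unfold shift_up, shift_down, nest_up, nest_down.
  destruct (left_of_total A B), (right_of_total A B), (below_total A B cA cB Hd); tauto.
Qed.

(** * Fractional Helly by sampling *)

Definition indic (P : Prop) : R := if excluded_middle_informative P then 1 else 0.

Lemma indic_true (P : Prop) : P -> indic P = 1.
Proof. unfold indic; destruct (excluded_middle_informative P); tauto. Qed.

Lemma indic_false (P : Prop) : ~ P -> indic P = 0.
Proof. unfold indic; destruct (excluded_middle_informative P); tauto. Qed.

Lemma indic_ge0 P : 0 <= indic P.
Proof. unfold indic; destruct (excluded_middle_informative P); lra. Qed.

Fixpoint lsum {T : Type} (f : T -> R) (l : list T) : R :=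
  match l with [] => 0 | x :: l => f x + lsum f l end.

Section Lsum.
Context {T : Type}.
Implicit Types (f g : T -> R) (l : list T).

Lemma lsum_le f g l : (forall x, In x l -> f x <= g x) -> lsum f l <= lsum g l.
Proof.
  induction l as [|x l IH]; simpl; intros H; [lra|].
  specialize (IH (fun y Hy => H y (or_intror Hy))); specialize (H x (or_introl eq_refl)); lra.
Qed.

Lemma lsum_ext f g l : (forall x, In x l -> f x = g x) -> lsum f l = lsum g l.
Proof. intros H; apply Rle_antisym; apply lsum_le; intros x Hx; rewrite (H x Hx); lra. Qed.

Lemma lsum_plus f g l : lsum (fun x => f x + g x) l = lsum f l + lsum g l.
Proof. induction l; simpl; lra. Qed.

Lemma lsum_scal c f l : lsum (fun x => c * f x) l = c * lsum f l.
Proof. induction l; simpl; lra. Qed.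

Lemma lsum_scalr c f l : lsum (fun x => f x * c) l = lsum f l * c.
Proof. induction l; simpl; lra. Qed.

Lemma lsum_ge0 f l : (forall x, 0 <= f x) -> 0 <= lsum f l.
Proof. intros H; induction l as [|x l IH]; simpl; [lra|specialize (H x); lra]. Qed.

Lemma lsum_swap (f : T -> T -> R) l r :
  lsum (fun x => lsum (f x) r) l = lsum (fun y => lsum (fun x => f x y) l) r.
Proof.
  induction l as [|x l IH]; simpl.
  - induction r; simpl; lra.
  - rewrite IH, <- lsum_plus; reflexivity.
Qed.

Lemma lsum_term f l x : (forall y, 0 <= f y) -> In x l -> f x <= lsum f l.
Proof.
  intros Hf; induction l as [|y l IH]; simpl; [tauto|]; intros [->|H].
  - assert (Q := lsum_ge0 f l Hf); lra.
  - specialize (IH H); specialize (Hf y); lra.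
Qed.

Fixpoint lsum2 (h : T -> T -> R) (l : list T) : R :=
  match l with [] => 0 | x :: l => lsum (h x) l + lsum2 h l end.

Fixpoint lsum3 (h : T -> T -> T -> R) (l : list T) : R :=
  match l with [] => 0 | x :: l => lsum2 (h x) l + lsum3 h l end.

Variables (G : list T) (w : T -> R).

Definition mean f : R := lsum (fun x => w x * f x) G.

(* The expectation of [f] over sequences of [m] independent elements of [G] with law [w]. *)
Fixpoint expect (m : nat) (f : list T -> R) : R :=
  match m with
  | O => f []
  | S m => mean (fun x => expect m (fun s => f (x :: s)))
  end.

Hypothesis w_ge0 : forall x, In x G -> 0 <= w x.
Hypothesis w_sum : lsum w G = 1.

Lemma mean_ext f g : (forall x, In x G -> f x = g x) -> mean f = mean g.
Proof. intros H; apply lsum_ext; intros x Hx; now rewrite H. Qed.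

Lemma mean_le f g : (forall x, In x G -> f x <= g x) -> mean f <= mean g.
Proof.
  intros H; apply lsum_le; intros x Hx; apply Rmult_le_compat_l; auto.
Qed.

Lemma mean_plus f g : mean (fun x => f x + g x) = mean f + mean g.
Proof. unfold mean; rewrite <- lsum_plus; apply lsum_ext; intros; ring. Qed.

Lemma mean_scal c f : mean (fun x => c * f x) = c * mean f.
Proof. unfold mean; rewrite <- lsum_scal; apply lsum_ext; intros; ring. Qed.

Lemma mean_const c : mean (fun _ => c) = c.
Proof. unfold mean; rewrite lsum_scalr, w_sum; ring. Qed.

Lemma mean_swap (h : T -> T -> R) :
  mean (fun x => mean (h x)) = mean (fun y => mean (fun x => h x y)).
Proof.
  unfold mean.
  transitivity (lsum (fun x => lsum (fun y => w x * (w y * h x y)) G) G).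
  - apply lsum_ext; intros; now rewrite lsum_scal.
  - rewrite lsum_swap; apply lsum_ext; intros; rewrite <- lsum_scal.
    apply lsum_ext; intros; ring.
Qed.

Lemma expect_plus m : forall f g : list T -> R,
  expect m (fun s => f s + g s) = expect m f + expect m g.
Proof.
  induction m as [|m IH]; intros f g; simpl; [reflexivity|].
  rewrite <- mean_plus; apply mean_ext; intros; apply IH.
Qed.

Lemma expect_const m c : expect m (fun _ => c) = c.
Proof.
  induction m as [|m IH]; simpl; [reflexivity|].
  transitivity (mean (fun _ => c)); [|apply mean_const].
  apply mean_ext; intros; apply IH.
Qed.

(** Conditional expectations: some first element keeps the expectation over the remaining ones below
    [v], since otherwise the mean would be at least [v]. *)
Lemma expect_lt m : forall (f : list T -> R) v, expect m f < v ->
  exists s, length s = m /\ incl s G /\ f s < v.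
Proof.
  induction m as [|m IH]; intros f v H; simpl in H.
  - exists []; repeat split; auto using incl_nil_l.
  - destruct (classic (exists x, In x G /\ expect m (fun s => f (x :: s)) < v))
      as [(x & Hx & Hlt)|Hno].
    + destruct (IH _ _ Hlt) as (s & Hs & Hi & Hf); exists (x :: s).
      repeat split; [simpl; auto|apply incl_cons; auto|auto].
    + exfalso; assert (Q : mean (fun _ => v) <= mean (fun x => expect m (fun s => f (x :: s)))).
      { apply mean_le; intros x Hx; apply Rnot_lt_le; intros Hlt; apply Hno; eauto. }
      rewrite mean_const in Q; lra.
Qed.

Lemma expect_lsum m h : expect m (lsum h) = INR m * mean h.
Proof.
  induction m as [|m IH]; [simpl; ring|].
  rewrite S_INR; simpl.
  rewrite (mean_ext _ (fun x => h x + INR m * mean h)).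
  - rewrite mean_plus, mean_const; ring.
  - intros x _; rewrite expect_plus, expect_const, IH; reflexivity.
Qed.

(** The factor counts the pairs of positions, each filled by two independent samples. [expect_lsum3]
    counts triples in the same way. *)
Lemma expect_lsum2 m h :
  expect m (lsum2 h) = INR m * (INR m - 1) / 2 * mean (fun x => mean (h x)).
Proof.
  induction m as [|m IH]; [simpl; lra|].
  rewrite S_INR; simpl.
  rewrite (mean_ext _ (fun x => INR m * mean (h x) +
    INR m * (INR m - 1) / 2 * mean (fun x => mean (h x)))).
  - rewrite mean_plus, mean_scal, mean_const; field.
  - intros x _; rewrite expect_plus, expect_lsum, IH; reflexivity.
Qed.

Lemma expect_lsum3 m h :
  expect m (lsum3 h) = INR m * (INR m - 1) * (INR m - 2) / 6
    * mean (fun x => mean (fun y => mean (h x y))).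
Proof.
  induction m as [|m IH]; [simpl; lra|].
  rewrite S_INR; simpl.
  rewrite (mean_ext _ (fun x => INR m * (INR m - 1) / 2 * mean (fun y => mean (h x y)) +
    INR m * (INR m - 1) * (INR m - 2) / 6
      * mean (fun x => mean (fun y => mean (h x y))))).
  - rewrite mean_plus, mean_scal, mean_const; field.
  - intros x _; rewrite expect_plus, expect_lsum2, IH; reflexivity.
Qed.

End Lsum.

(** * Removing repetitions and bad triples from a sample *)

Section Deletion.
Context {T : Type} (bad : T -> T -> T -> Prop).

Fixpoint sparse (s : list T) : Prop :=
  match s with
  | [] => True
  | x :: s => ~ In x s /\ ForallOrdPairs (fun y z => ~ bad x y z) s /\ sparse s
  end.

Lemma lsum2_ge0 (h : T -> T -> R) s : (forall x y, 0 <= h x y) -> 0 <= lsum2 h s.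
Proof.
  intros H; induction s as [|x s IH]; simpl; [lra|].
  assert (Q := lsum_ge0 (h x) s (H x)); lra.
Qed.

Lemma lsum2_indic_ge1 (Q : T -> T -> Prop) s :
  ~ ForallOrdPairs (fun y z => ~ Q y z) s -> 1 <= lsum2 (fun y z => indic (Q y z)) s.
Proof.
  induction s as [|x s IH]; intros H; [exfalso; apply H; constructor|]; simpl.
  destruct (classic (exists y, In y s /\ Q x y)) as [(y & Hy & Hq)|Hno].
  - assert (P1 := lsum_term (fun z => indic (Q x z)) s y (fun z => indic_ge0 _) Hy).
    assert (P2 := lsum2_ge0 (fun y z => indic (Q y z)) s (fun _ _ => indic_ge0 _)).
    simpl in P1; rewrite (indic_true (Q x y)) in P1 by auto; lra.
  - assert (P1 := lsum_ge0 (fun z => indic (Q x z)) s (fun z => indic_ge0 _)).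
    assert (P2 : 1 <= lsum2 (fun y z => indic (Q y z)) s); [|lra].
    apply IH; intros HF; apply H; constructor; auto.
    apply Forall_forall; intros y Hy Hq; eauto.
Qed.

(** Scanning from the tail, an element is dropped if it repeats a kept one or heads a bad triple
    with two kept ones. That pair or triple starts at the dropped element, so different deletions
    are charged to different terms. *)
Lemma delete_bad (s : list T) : exists s',
  sparse s' /\ incl s' s /\
  INR (length s) <= INR (length s') +
    (lsum3 (fun x y z => indic (bad x y z)) s + lsum2 (fun x y => indic (x = y)) s).
Proof.
  (* The conflict is found in the kept list [s'] but charged to [s], so the induction also carries
     that sums over [s'] are dominated by those over [s]. *)
  enough (H : exists s', sparse s' /\ incl s' s /\
    (forall h, (forall x, 0 <= h x) -> lsum h s' <= lsum h s) /\
    (forall h, (forall x y, 0 <= h x y) -> lsum2 h s' <= lsum2 h s) /\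
    INR (length s) <= INR (length s') +
    (lsum3 (fun x y z => indic (bad x y z)) s + lsum2 (fun x y => indic (x = y)) s)).
  { destruct H as (s' & H1 & H2 & _ & _ & H3); eauto. }
  induction s as [|x s (s' & H1 & H2 & H3 & H4 & H5)].
  - exists []; simpl; repeat split; auto using incl_nil_l; intros; lra.
  - assert (P1 := lsum2_ge0 (fun y z => indic (bad x y z)) s (fun _ _ => indic_ge0 _)).
    assert (P2 := lsum_ge0 (fun y => indic (x = y)) s (fun _ => indic_ge0 _)).
    assert (Q1 := H3 (fun y => indic (x = y)) (fun _ => indic_ge0 _)).
    assert (Q2 := H4 (fun y z => indic (bad x y z)) (fun _ _ => indic_ge0 _)).
    cbn [length lsum2 lsum3]; rewrite S_INR.
    destruct (classic (In x s' \/ ~ ForallOrdPairs (fun y z => ~ bad x y z) s')) as [Hb|Hg].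
    + exists s'; repeat split; auto using incl_tl.
      * intros h Hh; simpl; specialize (H3 h Hh); specialize (Hh x); lra.
      * intros h Hh; simpl; specialize (H4 h Hh).
        assert (R := lsum_ge0 (h x) s (Hh x)); lra.
      * assert (1 <= lsum2 (fun y z => indic (bad x y z)) s + lsum (fun y => indic (x = y)) s); [|lra].
        destruct Hb as [Hb|Hb].
        -- assert (R := lsum_term (fun y => indic (x = y)) s' x (fun _ => indic_ge0 _) Hb).
           simpl in R; rewrite indic_true in R by auto; lra.
        -- assert (R := lsum2_indic_ge1 _ _ Hb); lra.
    + exists (x :: s'); repeat split; auto.
      * apply NNPP; tauto.
      * apply incl_cons; [now left|now apply incl_tl].
      * intros h Hh; simpl; specialize (H3 h Hh); lra.
      * intros h Hh; simpl; specialize (H3 (h x) (Hh x)); specialize (H4 h Hh); lra.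
      * cbn [length]; rewrite S_INR; lra.
Qed.

Lemma sparse_nodup s : sparse s -> NoDup s.
Proof. induction s as [|x s IH]; simpl; constructor; tauto. Qed.

Hypothesis bad_swap12 : forall x y z, bad x y z -> bad y x z.
Hypothesis bad_swap23 : forall x y z, bad x y z -> bad x z y.

Lemma sparse_spec s : sparse s -> forall x y z, In x s -> In y s -> In z s ->
  x <> y -> x <> z -> y <> z -> ~ bad x y z.
Proof.
  induction s as [|a s IH]; simpl; [tauto|]; intros (_ & HF & Hs).
  assert (Key : forall y z, In y s -> In z s -> y <> z -> ~ bad a y z).
  { intros y z Hy Hz Hne Hb.
    destruct (ForallOrdPairs_In HF y z Hy Hz) as [H|[H|H]]; [auto|auto|].
    apply H; auto. }
  intros x y z [<-|Hx] [<-|Hy] [<-|Hz] N1 N2 N3 Hb; try congruence.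
  - apply (Key y z); auto.
  - apply (Key x z); auto.
  - apply (Key x y); auto.
  - apply (IH Hs x y z); auto.
Qed.

End Deletion.

Definition meet3 (A B D : region) : Prop := nonempty (fun x => A x /\ B x /\ D x).

(* If every point had small weight, a random sample of [2 P] members would contain few
   meeting triples: each is charged to the lexicographic minimum of one of its pairs. *)
Lemma deep_point_normalized (G : list region) (w : region -> R) (P : nat) :
  (forall A, In A G -> is_compact A /\ is_convex A /\ nonempty A) ->
  (forall A, In A G -> 0 <= w A) -> lsum w G = 1 -> (1 <= P)%nat ->
  (forall s, NoDup s -> incl s G -> (P <= length s)%nat ->
     exists A B D, In A s /\ In B s /\ In D s /\ A <> B /\ A <> D /\ B <> D /\ meet3 A B D) ->
  exists x, 1 <= INR (4 * (P * P)) * lsum (fun A => w A * indic (A x)) G.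
Proof.
  intros HG Hw Hsum HP Htriple.
  assert (HPR : 1 <= INR P) by (now apply (le_INR 1)).
  assert (HM : INR (4 * (P * P)) = 4 * (INR P * INR P)).
  { rewrite !mult_INR; simpl; ring. }
  apply NNPP; intros Hno.
  set (b := / INR (4 * (P * P))).
  assert (HMpos : 0 < INR (4 * (P * P))) by (rewrite HM; nra).
  assert (Hdepth : forall x, mean G w (fun A => indic (A x)) <= b).
  { intros x; unfold mean; apply Rnot_lt_le; intros Hlt; apply Hno; exists x.
    apply Rmult_le_reg_l with b; [now apply Rinv_0_lt_compat|].
    unfold b in *; rewrite <- Rmult_assoc, Rinv_l, Rmult_1_l, Rmult_1_r; lra. }
  (* For pairs without a minimum the value is arbitrary. This is harmless, since [Hdepth] bounds the
     depth of every point. *)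
  set (z := fun A B => epsilon (inhabits (0, 0)) (lexmin (cap A B))).
  assert (H3 : mean G w (fun A => mean G w (fun B => mean G w (fun D =>
    indic (meet3 A B D)))) <= 3 * b).
  { apply Rle_trans with (mean G w (fun A => mean G w (fun B => mean G w (fun D =>
      indic (D (z A B)) + (indic (B (z A D)) + indic (A (z B D))))))).
    - apply mean_le; auto; intros A HA; apply mean_le; auto; intros B HB.
      apply mean_le; auto; intros D HD.
      assert (I1 := indic_ge0 (D (z A B))); assert (I2 := indic_ge0 (B (z A D)));
      assert (I3 := indic_ge0 (A (z B D))).
      destruct (classic (meet3 A B D)) as [HABD|Hn]; [|rewrite indic_false by auto; lra].
      rewrite (indic_true (meet3 A B D)) by auto.
      destruct (HG A HA) as (kA & cA & _), (HG B HB) as (kB & cB & _),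
        (HG D HD) as (kD & cD & _).
      destruct (compact_lexmin (fun x => A x /\ B x /\ D x)) as (p & Hp); auto.
      { apply compact_inter; auto; apply closed_inter; now apply compact_closed. }
      assert (Hz : forall S U, lexmin (cap S U) p -> z S U = p).
      { intros S U Hl; apply (lexmin_unique (cap S U)); auto.
        unfold z; apply epsilon_spec; eauto. }
      assert (Hp' := Hp); destruct Hp' as [(Ap & Bp & Dp) _].
      destruct (lexmin_triple A B D p cA cB cD Hp) as [H|[H|H]]; apply Hz in H;
        rewrite H in *.
      + rewrite (indic_true (D p)) in * by auto; lra.
      + rewrite (indic_true (B p)) in * by auto; lra.
      + rewrite (indic_true (A p)) in * by auto; lra.
    - assert (M1 : mean G w (fun A => mean G w (fun B => mean G w (fun D =>
        indic (D (z A B))))) <= b).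
      { rewrite <- (mean_const G w Hsum b); apply mean_le; auto; intros A _.
        rewrite <- (mean_const G w Hsum b); apply mean_le; auto. }
      assert (M2 : mean G w (fun A => mean G w (fun B => mean G w (fun D =>
        indic (B (z A D))))) <= b).
      { rewrite <- (mean_const G w Hsum b); apply mean_le; auto; intros A _.
        rewrite mean_swap, <- (mean_const G w Hsum b); apply mean_le; auto. }
      assert (M3 : mean G w (fun A => mean G w (fun B => mean G w (fun D =>
        indic (A (z B D))))) <= b).
      { rewrite mean_swap, <- (mean_const G w Hsum b); apply mean_le; auto; intros A _.
        rewrite mean_swap, <- (mean_const G w Hsum b); apply mean_le; auto. }
      rewrite (mean_ext G w _ (fun A => mean G w (fun B => mean G w (fun D =>
        indic (D (z A B)))) + (mean G w (fun B => mean G w (fun D => indic (B (z A D)))) +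
        mean G w (fun B => mean G w (fun D => indic (A (z B D))))))).
      + rewrite !mean_plus; lra.
      + intros A _; rewrite <- !mean_plus; apply mean_ext; intros B _.
        rewrite <- !mean_plus; reflexivity. }
  (* Sampling is with replacement. Drawing [A] again means drawing a set through any fixed point of
     [A], which has probability at most [b]. *)
  assert (H2 : mean G w (fun A => mean G w (fun B => indic (A = B))) <= b).
  { rewrite <- (mean_const G w Hsum b); apply mean_le; auto; intros A HA.
    destruct (HG A HA) as (_ & _ & x & Ax).
    apply Rle_trans with (2 := Hdepth x); apply mean_le; auto; intros B _.
    destruct (classic (A = B)) as [<-|Hne].
    - rewrite !indic_true by auto; lra.
    - rewrite indic_false by auto; apply indic_ge0. }
  (* With [m = 2 P] one has [m * m * b = 1]. The expected number of conflicts is then at most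
     [P - 1 + m * b / 2], which is less than [P], so more than [P] of the samples survive
     deletion. *)
  destruct (expect_lt G w Hw Hsum (2 * P) (fun s =>
    lsum3 (fun A B D => indic (meet3 A B D)) s + lsum2 (fun A B => indic (A = B)) s) (INR P))
    as (s & Hlen & Hincl & Hs).
  - rewrite expect_plus, expect_lsum3, expect_lsum2 by auto.
    rewrite mult_INR; simpl (INR 2).
    set (m := (1 + 1) * INR P).
    assert (Hm : 2 <= m) by (unfold m; lra).
    assert (Hmb : m * m * b = 1).
    { unfold b, m; rewrite HM; field; lra. }
    apply Rle_lt_trans with (m * (m - 1) * (m - 2) / 6 * (3 * b) + m * (m - 1) / 2 * b).
    + apply Rplus_le_compat; apply Rmult_le_compat_l; auto.
      * assert (0 <= m * (m - 1)) by nra; nra.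
      * nra.
    + replace (m * (m - 1) * (m - 2) / 6 * (3 * b) + m * (m - 1) / 2 * b)
        with (m * m * b * ((m - 2) / 2) + m * b / 2) by field.
      rewrite Hmb; assert (0 < b) by now apply Rinv_0_lt_compat.
      assert (m * b < 1) by nra; unfold m in *; lra.
  - destruct (delete_bad meet3 s) as (s' & Hsp & Hi & Hl).
    rewrite Hlen, mult_INR in Hl; simpl (INR 2) in Hl.
    destruct (Htriple s') as (A & B & D & HA & HB & HD & N1 & N2 & N3 & Hm).
    + now apply sparse_nodup in Hsp.
    + eapply incl_tran; eauto.
    + apply INR_le; lra.
    + revert Hm; apply (sparse_spec meet3) with s'; auto.
      * intros S U V (x & ? & ? & ?); exists x; auto.
      * intros S U V (x & ? & ? & ?); exists x; auto.
Qed.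

(** * Weak epsilon-nets *)

Lemma deep_point (G : list region) (w : region -> R) (P : nat) :
  (forall A, In A G -> is_compact A /\ is_convex A /\ nonempty A) ->
  (forall A, 0 < w A) -> (1 <= P)%nat ->
  (forall s, NoDup s -> incl s G -> (P <= length s)%nat ->
     exists A B D, In A s /\ In B s /\ In D s /\ A <> B /\ A <> D /\ B <> D /\ meet3 A B D) ->
  exists x, lsum w G <= INR (4 * (P * P)) * lsum (fun A => w A * indic (A x)) G.
Proof.
  intros HG Hw HP Ht; destruct G as [|A0 G]; [exists (0, 0); simpl; lra|].
  set (W := lsum w (A0 :: G)).
  assert (HW : 0 < W).
  { unfold W; simpl; assert (Q := lsum_ge0 w G (fun A => Rlt_le _ _ (Hw A))).
    specialize (Hw A0); lra. }
  assert (HiW : 0 < / W) by now apply Rinv_0_lt_compat.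
  destruct (deep_point_normalized (A0 :: G) (fun A => / W * w A) P) as (x & Hx); auto.
  - intros A _; specialize (Hw A); nra.
  - rewrite lsum_scal; fold W; field; lra.
  - exists x; apply Rmult_le_reg_l with (/ W); auto.
    unfold W at 2; fold W; rewrite Rinv_l by lra.
    apply Rle_trans with (1 := Hx); right.
    rewrite (lsum_ext _ (fun A => / W * (w A * indic (A x)))) by (intros; ring).
    rewrite lsum_scal; ring.
Qed.

(** * Multiplicative weights *)

Fixpoint hits (A : region) (X : list point) : nat :=
  match X with
  | [] => 0
  | x :: X => ((if excluded_middle_informative (A x) then 1 else 0) + hits A X)%nat
  end.

Lemma hits_app A X Y : hits A (X ++ Y) = (hits A X + hits A Y)%nat.
Proof. induction X; simpl; lia. Qed.

Lemma hits_perm A X Y : Permutation X Y -> hits A X = hits A Y.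
Proof. induction 1; simpl; lia. Qed.

Lemma hits_le_length A X : (hits A X <= length X)%nat.
Proof. induction X; simpl; [lia|destruct excluded_middle_informative; lia]. Qed.

Lemma hits_none A X : (forall x, In x X -> ~ A x) -> hits A X = 0%nat.
Proof.
  induction X as [|x X IH]; simpl; intros H; auto.
  destruct (excluded_middle_informative (A x)) as [Ax|Ax].
  - exfalso; exact (H x (or_introl eq_refl) Ax).
  - simpl; auto.
Qed.

(* Multiplicative weights: halving the weights of the members containing a deep point
   multiplies the total weight by at most [1 - 1/(2M)]. *)
Lemma reweighting (G : list region) (M : nat) :
  (1 <= M)%nat ->
  (forall w, (forall A, 0 < w A) ->
     exists x, lsum w G <= INR M * lsum (fun A => w A * indic (A x)) G) ->
  forall t, exists X, length X = t /\
    lsum (fun A => (1 / 2) ^ hits A X) G <= INR (length G) * (1 - / (2 * INR M)) ^ t.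
Proof.
  intros HM Hdeep t.
  assert (HMR : 1 <= INR M) by (now apply (le_INR 1)).
  assert (Hi : 0 < / INR M) by (apply Rinv_0_lt_compat; lra).
  assert (HiM : / INR M * INR M = 1) by (field; lra).
  assert (Hi1 : / INR M <= 1) by nra.
  induction t as [|t (X & HX & IH)].
  - exists []; split; auto; simpl.
    clear; induction G as [|A G IH]; [simpl; lra|].
    cbn [lsum length]; rewrite S_INR; lra.
  - destruct (Hdeep (fun A => (1 / 2) ^ hits A X)) as (x & Hx).
    { intros A; apply pow_lt; lra. }
    exists (x :: X); split; [simpl; auto|].
    rewrite (lsum_ext _ (fun A => (1 / 2) ^ hits A X
      + (- (1 / 2)) * ((1 / 2) ^ hits A X * indic (A x)))).
    + rewrite lsum_plus, lsum_scal.
      set (W := lsum (fun A => (1 / 2) ^ hits A X) G) in *.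
      set (D := lsum (fun A => (1 / 2) ^ hits A X * indic (A x)) G) in *.
      assert (HD : / INR M * W <= D).
      { apply Rmult_le_reg_l with (INR M); [lra|].
        rewrite <- Rmult_assoc, Rinv_r, Rmult_1_l by lra; exact Hx. }
      apply Rle_trans with ((1 - / (2 * INR M)) * W).
      * rewrite Rinv_mult; lra.
      * simpl; rewrite Rinv_mult.
        assert (0 <= 1 - / 2 * / INR M) by lra.
        rewrite Rinv_mult in IH; nra.
    + intros A _; unfold indic; simpl hits; destruct excluded_middle_informative; simpl; lra.
Qed.

(** With [y = 1 / (2 M)], Bernoulli's inequality [poly] gives [(1 + y)^(2 M) >= 2], while
    [(1 - y) (1 + y) <= 1]. *)
Lemma half_power (M : nat) : (1 <= M)%nat -> (1 - / (2 * INR M)) ^ (2 * M) <= 1 / 2.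
Proof.
  intros HM.
  assert (HMR : 1 <= INR M) by (now apply (le_INR 1)).
  set (y := / (2 * INR M)).
  assert (Hy : 0 < y) by (apply Rinv_0_lt_compat; lra).
  assert (Hy2 : y * (2 * INR M) = 1) by (unfold y; field; lra).
  assert (Hy1 : y <= 1) by nra.
  assert (H1 := poly (2 * M) y Hy).
  rewrite mult_INR in H1; simpl (INR 2) in H1.
  assert (H2 : ((1 - y) * (1 + y)) ^ (2 * M) <= 1 ^ (2 * M)) by (apply pow_incr; nra).
  rewrite pow1, Rpow_mult_distr in H2.
  assert (H3 : 0 <= (1 - y) ^ (2 * M)) by (apply pow_le; lra).
  fold y; assert ((1 - y) ^ (2 * M) * 2 <= (1 - y) ^ (2 * M) * (1 + y) ^ (2 * M));
    [apply Rmult_le_compat_l; lra|lra].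
Qed.

(** Every [2 M] rounds at least halve the bound on the total weight. After [2 L] such blocks it is
    at most [|G| / 4^L], hence at most [1 / 2^L]; a single member has weight [1 / 2^hits], so it was
    hit at least [L] times. *)
Lemma dense_multiset (G : list region) (M : nat) :
  (1 <= M)%nat ->
  (forall w, (forall A, 0 < w A) ->
     exists x, lsum w G <= INR M * lsum (fun A => w A * indic (A x)) G) ->
  exists L X, (1 <= L)%nat /\ length X = (4 * M * L)%nat /\
    forall A, In A G -> (L <= hits A X)%nat.
Proof.
  intros HM Hdeep; set (L := S (length G)).
  destruct (reweighting G M HM Hdeep (2 * M * (2 * L))) as (X & HX & Hsum).
  exists L, X; split; [unfold L; lia|]; split; [rewrite HX; ring|].
  intros A HA.
  assert (H1 := lsum_term (fun A => (1 / 2) ^ hits A X) G A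
    (fun A => pow_le (1 / 2) _ ltac:(lra)) HA); simpl in H1.
  rewrite pow_mult in Hsum.
  assert (H2 : ((1 - / (2 * INR M)) ^ (2 * M)) ^ (2 * L) <= (1 / 2) ^ (2 * L)).
  { apply pow_incr; split; [|now apply half_power].
    apply pow_le.
    assert (HMR : 1 <= INR M) by (now apply (le_INR 1)).
    assert (/ (2 * INR M) * (2 * INR M) = 1) by (field; lra).
    assert (0 < / (2 * INR M)) by (apply Rinv_0_lt_compat; lra); nra. }
  assert (H3 : INR (length G) <= 2 ^ L).
  { assert (Q := poly L 1 ltac:(lra)); replace (1 + 1) with 2 in Q by ring.
    unfold L in *; rewrite S_INR in Q; lra. }
  assert (H4 : (1 / 2) ^ L * 2 ^ L = 1).
  { rewrite <- Rpow_mult_distr; replace (1 / 2 * 2) with 1 by field; apply pow1. }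
  assert (H5 : 0 < (1 / 2) ^ L) by (apply pow_lt; lra).
  assert (H6 : (1 / 2) ^ (2 * L) = (1 / 2) ^ L * (1 / 2) ^ L).
  { rewrite <- pow_add; f_equal; lia. }
  assert (H7 : (1 / 2) ^ hits A X <= (1 / 2) ^ L).
  { assert (Q := pos_INR (length G)); rewrite H6 in H2.
    apply Rle_trans with (INR (length G) * ((1 / 2) ^ L * (1 / 2) ^ L)); [nra|].
    apply Rle_trans with (2 ^ L * ((1 / 2) ^ L * (1 / 2) ^ L)); [|nra].
    apply Rmult_le_compat_r; auto; nra. }
  apply Nat.nlt_ge; intros Hlt.
  replace L with (hits A X + S (L - S (hits A X)))%nat in H7 by lia.
  rewrite pow_add, <- tech_pow_Rmult in H7.
  assert (0 < (1 / 2) ^ hits A X) by (apply pow_lt; lra).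
  assert (0 < (1 / 2) ^ (L - S (hits A X))) by (apply pow_lt; lra).
  assert ((1 / 2) ^ (L - S (hits A X)) <= 1).
  { apply Rle_trans with (1 ^ (L - S (hits A X))); [apply pow_incr; lra|].
    rewrite pow1; lra. }
  assert ((1 / 2) ^ hits A X * (1 / 2) ^ (L - S (hits A X)) <= (1 / 2) ^ hits A X * 1)
    by (apply Rmult_le_compat_l; lra).
  lra.
Qed.

(** * Nets on a line and in the plane *)

Lemma sort_by (f : point -> R) (l : list point) : exists l',
  Permutation l l' /\ StronglySorted (fun x y => f x <= f y) l'.
Proof.
  assert (Hins : forall x l, StronglySorted (fun x y => f x <= f y) l -> exists l',
    Permutation (x :: l) l' /\ StronglySorted (fun x y => f x <= f y) l').
  { clear l; intros x l; induction l as [|y l IH]; intros Hs.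
    - exists [x]; split; auto; repeat constructor.
    - apply StronglySorted_inv in Hs; destruct Hs as [Hs Hf].
      destruct (Rle_dec (f x) (f y)) as [H|H].
      + exists (x :: y :: l); split; auto.
        constructor; [now constructor|]; constructor; auto.
        eapply Forall_impl; [|exact Hf]; simpl; intros; lra.
      + destruct (IH Hs) as (l' & Hp & Hs'); exists (y :: l'); split.
        * rewrite <- Hp; apply perm_swap.
        * constructor; auto; apply (Permutation_Forall Hp); constructor; auto; lra. }
  induction l as [|x l (l' & Hp & Hs)].
  - exists []; split; auto; constructor.
  - destruct (Hins x l' Hs) as (l'' & Hp' & Hs'); exists l''; split; auto.
    rewrite <- Hp'; now constructor.
Qed.

Lemma StronglySorted_app {T : Type} (Rel : T -> T -> Prop) l1 l2 :
  StronglySorted Rel (l1 ++ l2) ->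
  StronglySorted Rel l2 /\ forall x y, In x l1 -> In y l2 -> Rel x y.
Proof.
  induction l1 as [|a l1 IH]; simpl; intros H.
  - split; auto; intros x y [].
  - apply StronglySorted_inv in H; destruct H as [H Hf]; destruct (IH H) as [H1 H2].
    split; auto; intros x y [<-|Hx] Hy; auto.
    rewrite Forall_forall in Hf; apply Hf, in_or_app; auto.
Qed.

Lemma nat_floor_strict b : 0 < b -> exists s, INR s < b <= INR s + 1.
Proof.
  intros Hb; destruct (archimed (- b)) as [H1 H2].
  exists (Z.to_nat (- up (- b))).
  assert (Hz : (0 <= - up (- b))%Z).
  { assert (-1 < - up (- b))%Z; [|lia]; apply lt_IZR; rewrite opp_IZR; lra. }
  rewrite INR_IZR_INZ, Z2Nat.id, opp_IZR by auto; lra.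
Qed.

Definition between_closed (l : list point) (I : region) : Prop :=
  forall x y z, In x l -> In y l -> In z l ->
    snd x <= snd y <= snd z -> I x -> I z -> I y.

(** The net skips [s] points and takes the next, with [s] the largest integer below [b]: each net
    point pays for [s + 1 >= b] points. A set that misses [q] lies on one side of it, and the [s]
    points before [q] are too few. *)
Lemma line_net (b : R) : 0 < b -> forall l : list point,
  StronglySorted (fun x y : point => snd x <= snd y) l ->
  exists Q, INR (length Q) * b <= INR (length l) /\
    forall I, between_closed l I -> b <= INR (hits I l) -> exists q, In q Q /\ I q.
Proof.
  intros Hb; destruct (nat_floor_strict b Hb) as (s & Hs1 & Hs2).
  intros l; remember (length l) as n eqn:Hn; revert l Hn.
  induction n as [n IH] using lt_wf_ind; intros l Hn Hsort.
  destruct (le_lt_dec n s) as [Hle|Hlt].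
  - exists []; split; [simpl; rewrite Rmult_0_l; apply pos_INR|].
    intros I _ Hhit; exfalso.
    assert (Q := le_INR _ _ (hits_le_length I l)); apply le_INR in Hle; subst n; lra.
  - assert (Hsplit : exists l1 q l2, l = l1 ++ q :: l2 /\ length l1 = s).
    { exists (firstn s l).
      destruct (skipn s l) as [|q l2] eqn:E.
      - exfalso; assert (Q := length_skipn s l); rewrite E in Q; simpl in Q; lia.
      - exists q, l2; split; [rewrite <- E; symmetry; apply firstn_skipn|].
        apply firstn_length_le; lia. }
    destruct Hsplit as (l1 & q & l2 & -> & Hl1).
    rewrite length_app in Hn; simpl in Hn.
    destruct (StronglySorted_app _ _ _ Hsort) as [Hs Hord].
    apply StronglySorted_inv in Hs; destruct Hs as [Hs Hq].
    destruct (IH (length l2) ltac:(lia) l2 eq_refl Hs) as (Q & HQ & Hnet).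
    exists (q :: Q); split.
    + cbn [length]; rewrite S_INR, Hn, plus_INR, S_INR, Hl1; lra.
    + intros I HI Hhit.
      destruct (classic (I q)) as [Iq|Iq]; [exists q; simpl; auto|].
      destruct (classic (exists x, In x l1 /\ I x)) as [(x & Hx & Ix)|Hno].
      * exfalso; apply (Rlt_not_le _ _ Hs1), (Rle_trans _ _ _ Hhit), le_INR.
        rewrite hits_app; simpl; rewrite (hits_none I l2).
        -- destruct excluded_middle_informative; [contradiction|].
           assert (R := hits_le_length I l1); lia.
        -- intros z Hz Iz; apply Iq, (HI x q z); auto;
             try (apply in_or_app; simpl; auto; fail).
           split; [apply Hord; simpl; auto|].
           rewrite Forall_forall in Hq; auto.
      * destruct (Hnet I) as (q' & Hq' & Iq').
        -- intros x y z Hx Hy Hz; apply HI; apply in_or_app; simpl; auto.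
        -- replace (hits I l2) with (hits I (l1 ++ q :: l2)); auto.
           rewrite hits_app; simpl; rewrite (hits_none I l1) by (intros x Hx Ix; eauto).
           destruct excluded_middle_informative; [contradiction|reflexivity].
        -- exists q'; simpl; auto.
Qed.

(** The segment [uv] meets the vertical line at [c] here. If [u] and [v] have the same first
    coordinate, then under the hypothesis of [cross_spec] it is [c], and [u] is already on the
    line. *)
Definition cross (c : R) (u v : point) : point :=
  if Req_EM_T (fst u) (fst v) then u
  else (c, snd u + (c - fst u) / (fst v - fst u) * (snd v - snd u)).

Lemma cross_spec c u v (A : region) :
  fst u <= c <= fst v ->
  fst (cross c u v) = c /\ (is_convex A -> A u -> A v -> A (cross c u v)).
Proof.
  intros H; unfold cross; destruct (Req_EM_T (fst u) (fst v)) as [E|E].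
  - split; auto; lra.
  - split; auto; intros cA Au Av.
    set (t := (c - fst u) / (fst v - fst u)).
    assert (Ht : t * (fst v - fst u) = c - fst u) by (unfold t; field; lra).
    apply (convex_pt A v u t); auto; simpl; [split; nra|lra|ring].
Qed.

Lemma hits_crossings c (A : region) (L Rt : list point) :
  is_convex A -> (forall u v, In u L -> In v Rt -> fst u <= c <= fst v) ->
  (hits A L * hits A Rt <=
   hits A (map (fun p => cross c (fst p) (snd p)) (list_prod L Rt)))%nat.
Proof.
  intros cA; induction L as [|u L IH]; intros H; simpl; [lia|].
  rewrite map_app, hits_app, map_map; simpl.
  specialize (IH (fun u v Hu Hv => H u v (or_intror Hu) Hv)).
  destruct (excluded_middle_informative (A u)) as [Au|Au]; [|lia].
  assert (HR : (hits A Rt <= hits A (map (fun v => cross c u v) Rt))%nat); [|lia].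
  assert (Hu : forall v, In v Rt -> fst u <= c <= fst v) by (intros v Hv; apply H; simpl; auto).
  clear IH H; induction Rt as [|v Rt IH]; simpl; auto.
  specialize (IH (fun v Hv => Hu v (or_intror Hv))).
  destruct (excluded_middle_informative (A v)) as [Av|Av]; [|lia].
  destruct excluded_middle_informative as [Hc|Hc]; [lia|].
  exfalso; apply Hc, cross_spec; auto; apply Hu; simpl; auto.
Qed.

(* Weak epsilon-nets (Alon, Barany, Furedi and Kleitman): halve the points by a vertical
   line; a set with many points on both sides catches many of the crossings of the line
   by segments joining the two halves. *)
Lemma weak_net : forall (X : list point) (a : R), 0 < a -> exists Y,
  INR (length Y) * (a * a) <= 324 * (INR (length X) * INR (length X)) /\
  forall A, is_convex A -> a <= INR (hits A X) -> exists y, In y Y /\ A y.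
Proof.
  intros X; remember (length X) as n eqn:Hn; revert X Hn.
  induction n as [n IH] using lt_wf_ind; intros X Hn a Ha.
  assert (Hn0 := pos_INR n).
  destruct (Rlt_le_dec (INR n) a) as [Hlt|Hle].
  { exists []; split; [simpl; nra|]; intros A _ Hhit; exfalso.
    assert (Q := le_INR _ _ (hits_le_length A X)); rewrite <- Hn in Q; lra. }
  destruct (le_lt_dec n 1) as [Hn1|Hn1].
  { exists X; split.
    - rewrite <- Hn; apply le_INR in Hn1; simpl in Hn1; nra.
    - intros A _ Hhit; apply NNPP; intros Hno; rewrite hits_none in Hhit; [simpl in Hhit; lra|].
      intros x Hx Ax; eauto. }
  destruct (sort_by fst X) as (X' & Hperm & Hsort).
  assert (Hn' := Permutation_length Hperm).
  set (h := (n / 2)%nat).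
  assert (Hh : (n = 2 * h \/ n = 2 * h + 1)%nat).
  { unfold h; assert (Q := Nat.div_mod_eq n 2); assert (Q' := Nat.mod_upper_bound n 2); lia. }
  set (L := firstn h X'); set (Rt := skipn h X').
  assert (HL : length L = h) by (apply firstn_length_le; lia).
  assert (HR : length Rt = (n - h)%nat) by (unfold Rt; rewrite length_skipn; lia).
  assert (HX' : X' = L ++ Rt) by (symmetry; apply firstn_skipn).
  assert (Hc : exists c, forall u v, In u L -> In v Rt -> fst u <= c <= fst v).
  { rewrite HX' in Hsort; destruct (StronglySorted_app _ _ _ Hsort) as [Hs Hord].
    destruct Rt as [|v0 Rt']; [simpl in HR; lia|].
    apply StronglySorted_inv in Hs; destruct Hs as [_ Hf]; rewrite Forall_forall in Hf.
    exists (fst v0); intros u v Hu [<-|Hv]; split;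
      try (apply Hord; simpl; auto; fail); auto; lra. }
  destruct Hc as (c & Hc).
  (* A set with at least [a] hits but fewer than [3 / 4 * a] in each half has more than [a / 4] in
     both, hence at least [(a / 4)^2] crossings. *)
  destruct (IH h ltac:(lia) L (eq_sym HL) (3 / 4 * a) ltac:(lra)) as (YL & HYL & NL).
  destruct (IH (n - h)%nat ltac:(lia) Rt (eq_sym HR) (3 / 4 * a) ltac:(lra))
    as (YR & HYR & NR).
  set (W := map (fun p => cross c (fst p) (snd p)) (list_prod L Rt)).
  destruct (sort_by snd W) as (W' & HpW & HsW).
  destruct (line_net (a / 4 * (a / 4)) ltac:(nra) W' HsW) as (Q & HQ & NQ).
  exists (YL ++ YR ++ Q); split.
  - rewrite !length_app, !plus_INR.
    rewrite <- (Permutation_length HpW) in HQ; unfold W in HQ.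
    rewrite length_map, length_prod, HL, HR, mult_INR in HQ.
    set (n2 := (n - h)%nat) in *.
    assert (Hsum : INR n = INR h + INR n2) by (rewrite <- plus_INR; f_equal; lia).
    assert (Hd : INR n2 = INR h \/ INR n2 = INR h + 1).
    { destruct Hh; [left; f_equal; lia|right; rewrite <- S_INR; f_equal; lia]. }
    assert (Hh1 : 1 <= INR h) by (apply (le_INR 1); lia).
    rewrite Hsum.
    (* Here [576 = 324 * 16 / 9], the factor coming from the threshold [3 / 4 * a]. For equal halves
       a constant 36 would absorb the crossings; the split of three points into one and two requires
       288. *)
    assert (E : INR (length YL) * (a * a) + INR (length YR) * (a * a)
      + INR (length Q) * (a * a) <= 576 * (INR h * INR h + INR n2 * INR n2)
      + 16 * (INR h * INR n2)) by lra.
    destruct Hd as [Hd|Hd]; rewrite Hd in *; nra.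
  - intros A cA Hhit.
    rewrite (hits_perm A _ _ Hperm), HX', hits_app, plus_INR in Hhit.
    destruct (Rle_dec (3 / 4 * a) (INR (hits A L))) as [H1|H1].
    { destruct (NL A cA H1) as (y & Hy & Ay); exists y; split; auto.
      apply in_or_app; auto. }
    destruct (Rle_dec (3 / 4 * a) (INR (hits A Rt))) as [H2|H2].
    { destruct (NR A cA H2) as (y & Hy & Ay); exists y; split; auto.
      apply in_or_app; right; apply in_or_app; auto. }
    destruct (NQ A) as (y & Hy & Ay).
    + assert (Hfst : forall y, In y W' -> fst y = c).
      { intros y Hy; apply (Permutation_in _ (Permutation_sym HpW)) in Hy.
        apply in_map_iff in Hy; destruct Hy as ((u, v) & <- & Huv).
        apply in_prod_iff in Huv; apply (cross_spec c u v A), Hc; apply Huv. }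
      intros x y z Hx Hy Hz Hxyz Ax Az.
      apply Hfst in Hx, Hy, Hz.
      destruct (Req_dec (snd x) (snd z)) as [E|E].
      * replace y with x; auto; destruct x, y; simpl in *; f_equal; lra.
      * set (t := (snd y - snd x) / (snd z - snd x)).
        assert (Ht : t * (snd z - snd x) = snd y - snd x) by (unfold t; field; lra).
        apply (convex_pt A z x t); auto; [split; nra| |lra].
        rewrite Hx, Hy, Hz; ring.
    + rewrite <- (hits_perm A _ _ HpW).
      apply Rle_trans with (INR (hits A L * hits A Rt)).
      * rewrite mult_INR; apply Rmult_le_compat; lra.
      * apply le_INR, hits_crossings; auto.
    + exists y; split; auto; apply in_or_app; right; apply in_or_app; auto.
Qed.

Lemma finite_transversal (G : list region) (P : nat) :
  (forall A, In A G -> is_compact A /\ is_convex A /\ nonempty A) -> (1 <= P)%nat ->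
  (forall s, NoDup s -> incl s G -> (P <= length s)%nat ->
     exists A B D, In A s /\ In B s /\ In D s /\ A <> B /\ A <> D /\ B <> D /\ meet3 A B D) ->
  exists Y, INR (length Y) <= 82944 * INR P ^ 4 /\
    forall A, In A G -> exists y, In y Y /\ A y.
Proof.
  intros HG HP Ht.
  destruct (dense_multiset G (4 * (P * P))) as (L & X & HL & HX & Hhit); [nia| |].
  { intros w Hw; now apply deep_point. }
  assert (HLR : 1 <= INR L) by now apply (le_INR 1).
  (* [X] has [4 * (4 * P^2) * L] points, so the net has size at most
     [324 * (16 * P^2)^2 = 82944 * P^4]. *)
  destruct (weak_net X (INR L) ltac:(lra)) as (Y & HY & Hnet).
  exists Y; split.
  - apply Rmult_le_reg_r with (INR L * INR L); [nra|].
    apply Rle_trans with (1 := HY); right.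
    rewrite HX, !mult_INR; simpl; ring.
  - intros A HA; apply Hnet; [apply HG; auto|apply le_INR; auto].
Qed.

(** * Cliques, vertices and compactness *)

(** The elements without a predecessor form an antichain, and any chain among the others extends
    downwards by one. Either this antichain is large enough, or enough elements remain for the
    induction with one length less. *)
Lemma mirsky (P : region -> Prop) (Rel : region -> region -> Prop) (q : nat) :
  transitive_on P Rel ->
  forall l, NoDup l -> (forall A, In A l -> P A) ->
  (forall c, StronglySorted Rel c -> incl c l -> length c <> q) ->
  exists l', NoDup l' /\ incl l' l /\ (length l <= q * length l')%nat /\
    forall A B, In A l' -> In B l' -> ~ Rel A B.
Proof.
  intros Htr; induction q as [|q IH]; intros l Hl HP Hch.
  { exfalso; apply (Hch []); auto using incl_nil_l; constructor. }
  set (f := fun A => if excluded_middle_informative (exists B, In B l /\ Rel B A)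
    then false else true).
  assert (Hf1 : forall A, f A = true -> ~ exists B, In B l /\ Rel B A).
  { intros A; unfold f; destruct excluded_middle_informative; [discriminate|auto]. }
  assert (Hf2 : forall A, f A = false -> exists B, In B l /\ Rel B A).
  { intros A; unfold f; destruct excluded_middle_informative; [auto|discriminate]. }
  set (mins := filter f l); set (rest := filter (fun A => negb (f A)) l).
  assert (Hlen : (length mins + length rest = length l)%nat) by apply filter_length.
  destruct (Nat.eq_dec q 0) as [->|Hq].
  { exists []; repeat split; auto using incl_nil_l; [constructor|].
    destruct l as [|A l]; [simpl; lia|exfalso].
    apply (Hch [A]); auto.
    - repeat constructor.
    - intros B [<-|[]]; now left. }
  destruct (IH rest) as (l1 & N1 & I1 & L1 & A1).
  - now apply NoDup_filter.
  - intros A HA; apply filter_In in HA; apply HP, HA.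
  - intros c Hc Hi Hlc; destruct c as [|A c]; [simpl in Hlc; lia|].
    assert (HA := Hi A (or_introl eq_refl)); apply filter_In in HA.
    destruct HA as [HA HfA]; apply Bool.negb_true_iff in HfA.
    destruct (Hf2 A HfA) as (B & HB & HBA).
    assert (Hi' : incl (A :: c) l).
    { intros D HD; specialize (Hi D HD); apply filter_In in Hi; apply Hi. }
    apply (Hch (B :: A :: c)); [|now apply incl_cons|simpl in *; lia].
    constructor; auto; apply Forall_forall; intros D [<-|HD]; auto.
    apply StronglySorted_inv in Hc; destruct Hc as [_ Hc]; rewrite Forall_forall in Hc.
    apply (Htr B A D); auto; apply HP; auto; apply Hi'; simpl; auto.
  - destruct (le_lt_dec (length l) (S q * length mins)) as [Hm|Hm].
    + exists mins; repeat split; auto.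
      * now apply NoDup_filter.
      * intros A HA; apply filter_In in HA; apply HA.
      * intros A B HA HB HAB; apply filter_In in HA, HB.
        apply (Hf1 B); [apply HB|]; exists A; split; auto; apply HA.
    + exists l1; repeat split; auto.
      * intros A HA; apply I1, filter_In in HA; apply HA.
      * nia.
Qed.

Lemma StronglySorted_FOP {T : Type} (Rel : T -> T -> Prop) l :
  StronglySorted Rel l -> ForallOrdPairs Rel l.
Proof. induction 1; constructor; auto. Qed.

Lemma no_long_chain (F : setfamily) (p : nat) (Rel : region -> region -> Prop) l :
  pq_property p 2 F -> (forall A, In A l -> F A) ->
  (forall A B, Rel A B -> ~ nonempty (cap A B)) ->
  forall c, StronglySorted Rel c -> incl c l -> length c <> p.
Proof.
  intros (_ & Hne & Hpq) Hl Hdis c Hc Hi Hlen.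
  assert (HF : forall A, In A c -> F A) by auto.
  (* A repeated member would be related to itself, hence disjoint from itself, although no member is
     empty. *)
  assert (Hnd : NoDup c).
  { clear Hi Hlen; induction Hc as [|A c Hc IH Hf]; constructor; auto.
    - intros HA; rewrite Forall_forall in Hf; apply (Hdis A A (Hf A HA)).
      destruct (Hne A) as (x & Ax); [apply HF; now left|]; exists x; split; auto.
    - apply IH; intros B HB; apply HF; now right. }
  destruct (Hpq c (conj Hnd HF) Hlen) as (s & Hs & Nd & L2 & x & Hx).
  destruct s as [|A [|B [|]]]; simpl in L2; try lia.
  assert (HAB : A <> B) by (apply NoDup_cons_iff in Nd; simpl in Nd; intuition congruence).
  assert (HA : In A c) by (apply Hs; simpl; auto).
  assert (HB : In B c) by (apply Hs; simpl; auto).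
  assert (Ax : A x) by (apply Hx; simpl; auto).
  assert (Bx : B x) by (apply Hx; simpl; auto).
  destruct (ForallOrdPairs_In (StronglySorted_FOP _ _ Hc) A B HA HB) as [H|[H|H]]; auto.
  - apply (Hdis _ _ H); exists x; split; auto.
  - apply (Hdis _ _ H); exists x; split; auto.
Qed.

Lemma large_clique (F : setfamily) (p k : nat) l :
  pq_property p 2 F -> (1 <= p)%nat -> NoDup l ->
  (forall A, In A l -> F A) -> (forall A, In A l -> is_convex A) ->
  (k * p ^ 4 <= length l)%nat ->
  exists l', NoDup l' /\ incl l' l /\ (k <= length l')%nat /\
    forall A B, In A l' -> In B l' -> nonempty (cap A B).
Proof.
  intros Hpq Hp Nl HF HC Hlen.
  assert (Hsym : forall A B, below B A -> ~ nonempty (cap A B)).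
  { intros A B H (x & Ax & Bx); apply (below_disjoint B A H); exists x; split; auto. }
  (* Each of the four passes costs a factor [p]; what is left is an antichain for all four orders,
     so by [disjoint_comparable] its members intersect pairwise. *)
  destruct (mirsky is_convex shift_up p shift_up_trans l) as (l1 & N1 & I1 & L1 & F1); auto.
  { apply (no_long_chain F); auto; intros A B (_ & _ & H); now apply below_disjoint. }
  destruct (mirsky is_convex shift_down p shift_down_trans l1) as (l2 & N2 & I2 & L2 & F2); auto.
  { apply (no_long_chain F); auto; intros A B (_ & _ & H); auto. }
  destruct (mirsky is_convex nest_up p nest_up_trans l2) as (l3 & N3 & I3 & L3 & F3); auto.
  { apply (no_long_chain F); auto; intros A B (_ & _ & H); now apply below_disjoint. }
  destruct (mirsky is_convex nest_down p nest_down_trans l3) as (l4 & N4 & I4 & L4 & F4); auto.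
  { apply (no_long_chain F); auto; intros A B (_ & _ & H); auto. }
  exists l4; repeat split; auto.
  - repeat (eapply incl_tran; [eassumption|]); apply incl_refl.
  - assert (Hp4 : (k * p ^ 4 <= length l4 * p ^ 4)%nat).
    { apply Nat.le_trans with (1 := Hlen); apply Nat.le_trans with (1 := L1).
      replace (length l4 * p ^ 4)%nat with (p * (p * (p * (p * length l4))))%nat
        by (simpl; ring).
      repeat (apply Nat.mul_le_mono_l; eapply Nat.le_trans; [eassumption|]); auto. }
    apply Nat.mul_le_mono_pos_r in Hp4; auto.
    apply Nat.neq_0_lt_0, Nat.pow_nonzero; lia.
  - intros A B HA HB; apply NNPP; intros Hd.
    assert (A3 := I4 _ HA); assert (B3 := I4 _ HB).
    assert (A2 := I3 _ A3); assert (B2 := I3 _ B3).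
    assert (A1 := I2 _ A2); assert (B1 := I2 _ B2).
    destruct (disjoint_comparable A B) as [[H|[H|[H|H]]]|[H|[H|[H|H]]]]; auto;
      first [now apply (F1 _ _ A1 B1) | now apply (F2 _ _ A2 B2)
        | now apply (F3 _ _ A3 B3) | now apply (F4 _ _ HA HB)
        | now apply (F1 _ _ B1 A1) | now apply (F2 _ _ B2 A2)
        | now apply (F3 _ _ B3 A3) | now apply (F4 _ _ HB HA)].
Qed.

(** * Vertices of the union of a clique *)

Lemma interior_mono (S U : region) x :
  (forall y, S y -> U y) -> interior S x -> interior U x.
Proof. intros H (r & Hr & Hb); exists r; split; auto. Qed.

Lemma closure_self (S : region) x : S x -> closure S x.
Proof.
  intros Sx r Hr; exists x; split; auto; apply near_ball, near_self; lra.
Qed.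

(** No third set contains [z], and all of them are closed, so near [z] the whole union coincides
    with that of [A] and [B]. *)
Lemma pair_vertex (G : list region) A B z :
  (forall D, In D G -> is_compact D) -> In A G -> In B G -> A <> B ->
  (forall D, In D G -> A <> D -> B <> D -> ~ meet3 A B D) ->
  cap A B z -> ~ interior (cup A B) z -> is_vertex G z.
Proof.
  intros HG HA HB Hne Hno [Az Bz] Hint; split.
  - exists A, B; repeat split; auto using closure_self; intros H; apply Hint;
      revert H; apply interior_mono; unfold cup; auto.
  - split; [apply closure_self; exists A; auto|].
    intros H; apply Hint; clear Hint; apply interior_near in H.
    destruct H as (r & Hr & Hin).
    assert (Hs : exists s, 0 < s /\ forall D y, In D G -> near z s y -> D y -> cup A B y).
    { assert (Hz : forall D, In D G -> A <> D -> B <> D -> ~ D z).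
      { intros D HD N1 N2 Dz; apply (Hno D HD N1 N2); exists z; auto. }
      clear Hin HA HB Hno; induction G as [|D G IH].
      - exists 1; split; [lra|intros D y []].
      - destruct IH as (s & Hs & H).
        + intros E HE; apply HG; now right.
        + intros E HE; apply Hz; now right.
        + assert (HD : exists t, 0 < t /\ forall y, near z t y -> D y -> cup A B y).
          { destruct (classic (A = D \/ B = D)) as [E|E].
            - exists 1; split; [lra|]; intros y _ Dy; unfold cup.
              destruct E as [<-|<-]; auto.
            - destruct (compact_closed D (HG D (or_introl eq_refl)) z) as (t & Ht & Hd).
              + apply Hz; [now left|tauto|tauto].
              + exists t; split; auto; intros y Hy Dy; exfalso; exact (Hd y Hy Dy). }
          destruct HD as (t & Ht & Hd).
          exists (Rmin s t); split; [now apply Rmin_glb_lt|].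
          intros E y [<-|HE] Hy Ey.
          * apply Hd; auto; eapply near_le; [apply Rmin_r|exact Hy].
          * apply (H E); auto; eapply near_le; [apply Rmin_l|exact Hy]. }
    destruct Hs as (s & Hs & H).
    apply interior_near; exists (Rmin r s); split; [now apply Rmin_glb_lt|].
    intros y Hy; destruct (Hin y) as (D & HD & Dy).
    + eapply near_le; [apply Rmin_l|exact Hy].
    + apply (H D); auto; eapply near_le; [apply Rmin_r|exact Hy].
Qed.

(** Points chosen for different pairs are distinct, because a coincidence would lie in three sets.
    The count is doubled to avoid division and subtraction in [nat]. *)
Lemma pairwise_points (V : region -> region -> point -> Prop) (l : list region) :
  (forall A B v, V A B v -> cap A B v) -> NoDup l ->
  (forall A B, In A l -> In B l -> A <> B -> exists v, V A B v) ->
  (forall A B D, In A l -> In B l -> In D l ->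
     A <> B -> A <> D -> B <> D -> ~ meet3 A B D) ->
  exists vs, NoDup vs /\ (2 * length vs + length l = length l * length l)%nat /\
    forall v, In v vs -> exists A B, In A l /\ In B l /\ A <> B /\ V A B v.
Proof.
  intros HV; induction l as [|A l IH]; intros Nl Hex Hno.
  { exists []; split; [constructor|]; split; [reflexivity|intros v []]. }
  apply NoDup_cons_iff in Nl; destruct Nl as [HA Nl].
  assert (Hne : forall B, In B l -> A <> B) by (intros B HB ->; auto).
  destruct IH as (vs & Nv & Lv & Hv); auto.
  { intros B D HB HD; apply Hex; simpl; auto. }
  { intros B D E HB HD HE; apply Hno; simpl; auto. }
  assert (Hus : exists us, NoDup us /\ length us = length l /\
    forall u, In u us -> exists B, In B l /\ V A B u).
  { clear vs Nv Lv Hv; revert Nl; induction l as [|B l IH2]; intros Nl.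
    - exists []; split; [constructor|]; split; [reflexivity|intros u []].
    - apply NoDup_cons_iff in Nl; destruct Nl as [HB Nl].
      destruct IH2 as (us & Nu & Lu & Hu); auto.
      { simpl in HA; tauto. }
      { intros D E HD HE; apply Hex; simpl in *; tauto. }
      { intros D E E' HD HE HE'; apply Hno; simpl in *; tauto. }
      { intros D HD; apply Hne; now right. }
      destruct (Hex A B) as (u & Hub); [simpl; auto..|apply Hne; now left|].
      exists (u :: us); split; [|split].
      + constructor; auto; intros Hin; destruct (Hu u Hin) as (D & HD & HuD).
        apply HV in Hub, HuD; apply (Hno A B D); simpl; auto.
        * apply Hne; simpl; auto.
        * apply Hne; simpl; auto.
        * intros ->; auto.
        * exists u; unfold cap in *; tauto.
      + simpl; auto.
      + intros u' [<-|Hu']; [exists B; simpl; auto|].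
        destruct (Hu u' Hu') as (D & HD & HuD); exists D; simpl; auto. }
  destruct Hus as (us & Nu & Lu & Hu).
  exists (us ++ vs); split; [|split].
  - apply NoDup_app; auto; intros u Hin Hin'.
    destruct (Hu u Hin) as (B & HB & HuB); destruct (Hv u Hin') as (D & E & HD & HE & N & HuE).
    apply HV in HuB, HuE; apply (Hno A D E); simpl; auto.
    exists u; unfold cap in *; tauto.
  - rewrite length_app; simpl; nia.
  - intros v Hin; apply in_app_or in Hin; destruct Hin as [Hin|Hin].
    + destruct (Hu v Hin) as (B & HB & HuB); exists A, B; simpl; auto.
    + destruct (Hv v Hin) as (D & E & HD & HE & N & HuE); exists D, E; simpl; auto.
Qed.

Lemma clique_vertices (G : list region) :
  NoDup G -> (3 <= length G)%nat ->
  (forall A, In A G -> is_compact A /\ is_convex A) ->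
  (forall A B, In A G -> In B G -> nonempty (cap A B)) ->
  (forall A B D, In A G -> In B G -> In D G ->
     A <> B -> A <> D -> B <> D -> ~ meet3 A B D) ->
  ~ union_complexity_lt G (length G * (length G - 1) / 2).
Proof.
  intros NG LG HG Hmeet Hno Hlt.
  (* If [A] were contained in [B], a third member meeting [A] would meet both in one point. This is
     where at least three sets are required. *)
  assert (Hdiff : forall A B, In A G -> In B G -> A <> B -> exists x, A x /\ ~ B x).
  { intros A B HA HB Hne; apply NNPP; intros Hsub.
    assert (HD : exists D, In D G /\ A <> D /\ B <> D).
    { apply NNPP; intros H; assert (Q : incl G [A; B]).
      { intros D HD; simpl; apply NNPP; intros HN; apply H; exists D; tauto. }
      apply NoDup_incl_length in Q; auto; simpl in Q; lia. }
    destruct HD as (D & HD & N1 & N2); apply (Hno A B D); auto.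
    destruct (Hmeet A D HA HD) as (x & Ax & Dx); exists x; repeat split; auto.
    apply NNPP; intros Bx; apply Hsub; eauto. }
  destruct (pairwise_points (fun A B v => cap A B v /\ ~ interior (cup A B) v) G)
    as (vs & Nv & Lv & Hv); auto.
  - intros A B v H; apply H.
  - intros A B HA HB Hne; destruct (HG A HA), (HG B HB).
    apply vertex_exists; auto.
  - assert (Hlen : (length G * (length G - 1) = length vs * 2)%nat) by nia.
    rewrite Hlen, Nat.div_mul in Hlt by lia.
    apply (Nat.lt_irrefl (length vs)), Hlt; auto.
    intros v Hin; destruct (Hv v Hin) as (A & B & HA & HB & Hne & Hc & Hi).
    apply (pair_vertex G A B v); auto.
    intros D HD; apply HG; auto.
Qed.

(** * From finite subfamilies to the whole family *)

Definition pierced (N : nat) (F : setfamily) : Prop :=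
  exists Y : list point, (length Y <= N)%nat /\ is_transversal Y F.

(** If [N + 1] points do not suffice, then for each [x] in a fixed member [A0] the members missing
    [x] are not pierced by [N] points, and by induction some finite part [G] of them is not. All
    points near [x] miss this [G] too. Finitely many such neighbourhoods cover [A0], and their lists
    [G] together with [A0] form a finite family that [N + 1] points cannot pierce. *)
Lemma pierced_compactness (N : nat) : forall F : setfamily,
  (forall A, F A -> is_compact A) ->
  (forall G : list region, (forall A, In A G -> F A) -> pierced N (fun A => In A G)) ->
  pierced N F.
Proof.
  induction N as [|N IH]; intros F HF Hfin.
  { exists []; split; auto; intros A FA; exfalso.
    destruct (Hfin [A]) as (Y & HY & HT); [intros B [<-|[]]; auto|].
    destruct Y; [|simpl in HY; lia]; destruct (HT A) as (y & [] & _); now left. }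
  destruct (classic (exists A, F A)) as [(A0 & FA0)|Hno].
  2:{ exists []; split; [simpl; lia|]; intros A FA; exfalso; eauto. }
  apply NNPP; intros Hnp.
  set (avoid := fun (U : region) (G : list region) => forall A, In A G -> forall y, U y -> ~ A y).
  destruct (HF A0 FA0 (fun U => is_open U /\ exists G, (forall A, In A G -> F A) /\
    avoid U G /\ ~ pierced N (fun A => In A G))) as (l & Hl & Hcov).
  - intros U [HU _]; auto.
  - intros x A0x.
    assert (HG : exists G, (forall A, In A G -> F A /\ ~ A x) /\
      ~ pierced N (fun A => In A G)).
    { apply NNPP; intros HG; apply Hnp.
      destruct (IH (fun A => F A /\ ~ A x)) as (Y & HY & HT).
      - intros A [FA _]; auto.
      - intros G HGx; apply NNPP; intros Hn; apply HG; eauto.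
      - exists (x :: Y); split; [simpl; lia|]; intros A FA.
        destruct (classic (A x)) as [Ax|Ax]; [exists x; simpl; auto|].
        destruct (HT A (conj FA Ax)) as (y & Hy & Ay); exists y; simpl; auto. }
    destruct HG as (G & HG & Hn).
    exists (fun y => forall A, In A G -> ~ A y); split; [split|].
    + apply is_open_near; intros y Hy.
      assert (HGc : forall A, In A G -> is_compact A) by (intros A HA; apply HF, HG, HA).
      clear Hn HG; induction G as [|A G IHG].
      * exists 1; split; [lra|intros z _ B []].
      * destruct IHG as (r & Hr & H); [intros B HB; apply Hy; now right| |].
        { intros B HB; apply HGc; now right. }
        destruct (compact_closed A (HGc A (or_introl eq_refl)) y) as (s & Hs & H').
        { apply Hy; now left. }
        exists (Rmin r s); split; [now apply Rmin_glb_lt|].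
        intros z Hz B [<-|HB].
        -- apply H'; eapply near_le; [apply Rmin_r|exact Hz].
        -- apply H; auto; eapply near_le; [apply Rmin_l|exact Hz].
    + exists G; repeat split; auto.
      * intros A HA; apply HG, HA.
      * intros A HA y Hy; apply Hy, HA.
    + intros A HA; apply HG, HA.
  - assert (HH : exists H, (forall A, In A H -> F A) /\ forall U, In U l ->
      exists G, incl G H /\ avoid U G /\ ~ pierced N (fun A => In A G)).
    { clear Hcov; induction l as [|U l IHl].
      - exists []; split; [intros A []|intros U []].
      - destruct IHl as (H & HH & Hc); [intros V HV; apply Hl; now right|].
        destruct (Hl U (or_introl eq_refl)) as (_ & G & HG & Hav & Hn).
        exists (G ++ H); split.
        + intros A HA; apply in_app_or in HA; destruct HA; auto.
        + intros V [<-|HV].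
          * exists G; split; auto using incl_appl, incl_refl.
          * destruct (Hc V HV) as (G' & Hi & HG'); exists G'; split; auto using incl_appr. }
    destruct HH as (H & HH & Hc).
    destruct (Hfin (A0 :: H)) as (Y & HY & HT).
    { intros A [<-|HA]; auto. }
    destruct (HT A0) as (y & Hy & A0y); [now left|].
    destruct (Hcov y A0y) as (U & HU & Uy), (Hc U HU) as (G & Hi & Hav & Hn).
    (* The point [y] of the transversal that lies in [A0] meets no member of [G], so the other
       points pierce [G], and there are at most [N] of them. *)
    apply Hn; apply in_split in Hy; destruct Hy as (Y1 & Y2 & ->).
    exists (Y1 ++ Y2); split; [rewrite length_app in *; simpl in HY; lia|].
    intros A HA; destruct (HT A) as (z & Hz & Az); [right; auto|].
    exists z; split; auto; apply in_app_or in Hz; apply in_or_app.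
    destruct Hz as [Hz|[<-|Hz]]; auto; exfalso; exact (Hav A HA y Uy Az).
Qed.

Theorem theorem1p7 :
  exists C : R,
    forall (p k : nat) (F : setfamily),
      (2 <= p)%nat -> (3 <= k)%nat ->
      (forall A : region, F A -> is_compact A /\ is_convex A) ->
      pq_property p 2 F ->
      (forall G, members F G -> length G = k ->
         union_complexity_lt G (k * (k - 1) / 2)%nat) ->
      exists T : list point,
        is_transversal T F /\
        INR (length T) <= C * INR k ^ 4 * INR p ^ 16.
Proof.
  exists 82944; intros p k F Hp Hk HF Hpq Huc.
  assert (Hne : forall A, F A -> nonempty A) by apply Hpq.
  set (P := (k * p ^ 4)%nat).
  assert (HP : (1 <= P)%nat).
  { unfold P; assert (p ^ 4 <> 0)%nat by (apply Nat.pow_nonzero; lia); nia. }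
  assert (Htriple : forall s, NoDup s -> (forall A, In A s -> F A) -> (P <= length s)%nat ->
    exists A B D, In A s /\ In B s /\ In D s /\ A <> B /\ A <> D /\ B <> D /\ meet3 A B D).
  { intros s Ns Fs Ls; apply NNPP; intros Hno.
    destruct (large_clique F p k s) as (l & Nl & Il & Ll & Ml); auto; [lia| |].
    { intros A HA; apply HF, Fs, HA. }
    assert (Hk' : length (firstn k l) = k) by now apply firstn_length_le.
    assert (Hi : incl (firstn k l) l).
    { intros A HA; rewrite <- (firstn_skipn k l); apply in_or_app; auto. }
    assert (HG : forall A, In A (firstn k l) -> In A s) by auto.
    assert (Nk : NoDup (firstn k l)).
    { rewrite <- (firstn_skipn k l) in Nl; apply NoDup_app_remove_r in Nl; auto. }
    apply (clique_vertices (firstn k l)); auto.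
    - lia.
    - intros A B D HA HB HD N1 N2 N3 Hm; apply Hno; exists A, B, D; auto 10.
    - rewrite Hk'; apply Huc; auto; split; auto. }
  (* The bound [82944 * P^4] of [finite_transversal] as a natural number, which makes it uniform
     over all finite subfamilies for the compactness argument. *)
  set (N := (288 * 288 * (P * P * P * P))%nat).
  assert (HN : INR N = 82944 * INR P ^ 4).
  { unfold N; rewrite !mult_INR; replace (INR 288) with 288; [ring|].
    now rewrite INR_IZR_INZ. }
  destruct (pierced_compactness N F) as (T & HT & HTF).
  - intros A FA; apply HF, FA.
  - intros G FG; destruct (finite_transversal G P) as (Y & HY & HYG); auto.
    + intros A HA; destruct (HF A (FG A HA)); auto.
    + exists Y; split; [apply INR_le; lra|exact HYG].
  - exists T; split; auto.
    apply Rle_trans with (INR N); [now apply le_INR|].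
    rewrite HN; unfold P; rewrite mult_INR, pow_INR; right; ring.
Qed.
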